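(* Let $\varphi(x)=\sum_{j=1}^\infty c_je^{-i\phi_jx}\gamma_j(x)$ on $(0,\infty)$, with $c_j\in\mathbb{C}$, $\phi_j\in\mathbb{R}$, $\gamma_j:(0,\infty)\to\mathbb{C}$, and let $\eta\in\mathbb{R}$ be such that 1. $\sup_j\mathrm{Var}(\gamma_j,(0,\infty))=:\tau<\infty$; 2. for some $p=2n+1$ with $n\ge1$ an integer, $\sup_j\int_0^\infty|\gamma_j(t)|^p\,dt=:\sigma<\infty$; 3. $\sum_{j=1}^\infty|c_j|<\infty$; 4. for all odd $I=1,3,\dots,p-2$ and $P:=\frac{I+1}{2}$, $$\sum_{\substack{k_1,\dots,k_P=1\\ l_1,\dots,l_{P-1}=1}}^\infty\Big|h_I\big(\eta;[\phi_{k_j}]_{j=1}^P;[\phi_{l_j}]_{j=1}^{P-1}\big)\prod_{j=1}^Pc_{k_j}\prod_{j=1}^{P-1}\overline{c_{l_j}}\Big|<\infty.$$ Then, for $E=\frac\eta2$, all solutions $U$ of $\Lambda_\varphi U=EU$ on $(0,\infty)$ are bounded.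
   Context: $\mathrm{Var}(\gamma,(0,\infty))$ is the supremum of $\sum_{j=1}^k|\gamma(x_j)-\gamma(x_{j-1})|$ over $k\in\mathbb{N}$ and $0<x_0<\dots<x_k$. $$\Lambda_\varphi=\begin{pmatrix}i&0\\0&-i\end{pmatrix}\frac{d}{dx}+\begin{pmatrix}0&\varphi(x)\\\overline{\varphi(x)}&0\end{pmatrix}.$$ $[\phi_j]_{j=a}^b$ denotes the ordered tuple $(\phi_a,\dots,\phi_b)$ (empty if $b<a$). The functions $h_I$, rational in $\eta$, are defined recursively: $h_I\equiv0$ for even $I$ (including $I=0$); $h_1(\eta;[\phi_{k_1}])=(\phi_{k_1}-\eta)^{-1}$; and for odd $I=2P-1\ge3$, $$h_I(\eta;[\phi_{k_j}]_{j=1}^P;[\phi_{l_j}]_{j=1}^{P-1})=\frac{1}{\sum_{j=1}^P\phi_{k_j}-\sum_{j=1}^{P-1}\phi_{l_j}-\eta}\sum_{m=0}^{I-1}h_m\big(\eta;[\phi_{k_j}]_{j=1}^{\frac{m+1}2};[\phi_{l_j}]_{j=1}^{\frac{m-1}2}\big)\,h_{I-1-m}\big(\eta;[\phi_{k_j}]_{j=\frac{m+3}2}^P;[\phi_{l_j}]_{j=\frac{m+1}2}^{P-2}\big),$$ where only odd $m$ contribute. The sum in condition 4 is regarded as infinite if $h_I$ has a pole at $\eta$ for some choice of indices with nonzero coefficient product; terms with zero coefficient product count as $0$. *)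

(* Defs.v *)
From HB Require Import structures.
From mathcomp Require Import all_boot all_order all_algebra.
From mathcomp.real_closed Require Import complex.
From mathcomp Require Import all_classical all_reals all_analysis.
From mathcomp Require Import fraction.

Set Implicit Arguments.
Unset Strict Implicit.
Unset Printing Implicit Defensive.

Import Order.TTheory GRing.Theory Num.Theory.
Import numFieldNormedType.Exports.
Import ComplexField.Normc.

Local Open Scope classical_set_scope.
Local Open Scope ring_scope.
Local Open Scope complex_scope.

(* Families indexed by j >= 1 on paper are indexed by nat, from 0.
   [normc] is the R-valued modulus of a complex number.  Functions on (0,oo)
   are total functions on R of which only the values at x > 0 are used. *)

Definition expi (R : realType) (t : R) : R[i] := cos t +i* sin t.

(* Var (g, (0,oo)) *)
Definition Var (R : realType) (g : R -> R[i]) : \bar R :=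
  ereal_sup [set v | exists (k : nat) (x : nat -> R),
    [/\ 0 < x 0%N,
        forall j, (j < k)%N -> x j < x j.+1
      & v = (\sum_(1 <= j < k.+1) normc (g (x j) - g (x j.-1)))%:E]].

Section Solutions.
Variable R : realType.
Implicit Types (f phi : R -> R[i]) (U : R -> 'cV[R[i]]_2).

(* Absolute continuity on every compact [a, b] contained in (0,oo). *)
Definition loc_abs_cont f : Prop :=
  forall a b : R, 0 < a -> a <= b -> forall e : R, 0 < e ->
  exists2 d : R, 0 < d &
    forall (n : nat) (x y : nat -> R),
      (forall i, (i < n)%N -> [/\ a <= x i, x i <= y i & y i <= b]) ->
      trivIset `I_n (fun i => `]x i, y i[%classic) ->
      \sum_(i < n) (y i - x i) < d ->
      \sum_(i < n) normc (f (y i) - f (x i)) < e.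

Definition cderivable f (x : R) : Prop :=
  derivable (fun t => complex.Re (f t)) x 1 /\ derivable (fun t => complex.Im (f t)) x 1.

Definition cderive f (x : R) : R[i] :=
  derive1 (fun t => complex.Re (f t)) x +i* derive1 (fun t => complex.Im (f t)) x.

Definition mx22 (a b c d : R[i]) : 'M[R[i]]_2 :=
  \matrix_(i, j) nth 0 (nth [::] [:: [:: a; b]; [:: c; d]] i) j.

(* (Lambda_phi U)(x) *)
Definition Lambda phi U (x : R) : 'cV[R[i]]_2 :=
  mx22 (0 +i* 1) 0
       0         (0 -i* 1) *m (\col_r cderive (fun t => U t r 0) x) +
  mx22 0         (phi x)
       (conjc (phi x)) 0 *m U x.

(* phi need not be continuous, so solutions are locally absolutely continuous
   functions satisfying the equation almost everywhere. *)
Definition Dirac_solution phi (E : R) U : Prop :=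
  (forall r, loc_abs_cont (fun t => U t r 0)) /\
  {ae @lebesgue_measure R, forall x : R, 0 < x ->
    (forall r, cderivable (fun t => U t r 0) x) /\
    Lambda phi U x = E%:C *: U x}.

Definition bounded_on_pos U : Prop :=
  exists M : R, forall x, 0 < x -> forall r, normc (U x r 0) <= M.

End Solutions.

(* Rational functions of one variable are elements of {fraction {poly R}}.  A
   pole is a root of the denominator in lowest terms, so that removable
   singularities are not poles; the value is that of the reduced fraction. *)
Section RationalFunctions.
Variable F : fieldType.
Implicit Types (r : {fraction {poly F}}) (a : F).

Local Notation num x := (frac x).1.
Local Notation den x := (frac x).2.

Definition rnum r : {poly F} :=
  num (repr r) %/ gcdp (num (repr r)) (den (repr r)).

Definition rden r : {poly F} :=
  den (repr r) %/ gcdp (num (repr r)) (den (repr r)).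

Definition is_pole r a : bool := root (rden r) a.

Definition reval r a : F := (rnum r).[a] / (rden r).[a].

Lemma rden_neq0 r : rden r != 0.
Proof.
have d0 : den (repr r) != 0 by apply: denom_ratioP.
by rewrite dvdp_div_eq0 ?dvdp_gcdr.
Qed.

Lemma coprime_rnum_rden r : coprimep (rnum r) (rden r).
Proof.
by apply: coprimep_div_gcd; rewrite denom_ratioP orbT.
Qed.

Lemma fraction_reduced r :
  r = @tofrac {poly F} (rnum r) / @tofrac {poly F} (rden r).
Proof.
have d0 : den (repr r) != 0 by apply: denom_ratioP.
have g0 : gcdp (num (repr r)) (den (repr r)) != 0.
  by rewrite gcdp_eq0 negb_and d0 orbT.
have gn : num (repr r) = rnum r * gcdp (num (repr r)) (den (repr r)).
  by rewrite divpK ?dvdp_gcdl.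
have gd : den (repr r) = rden r * gcdp (num (repr r)) (den (repr r)).
  by rewrite divpK ?dvdp_gcdr.
have E : r = @tofrac {poly F} (num (repr r)) / @tofrac {poly F} (den (repr r)).
  rewrite -[LHS]reprK; move: (repr r) d0 => x d0 {g0 gn gd}.
  change ((\pi_(FracField.type {poly F}) x)%qT =
    FracField.mul (FracField.tofrac (num x))
      (FracField.inv (FracField.tofrac (den x))) :> FracField.type {poly F}).
  rewrite !piE /FracField.invf /FracField.mulf.
  by rewrite !numden_Ratio ?oner_neq0 // mulr1 mul1r FracField.Ratio_numden.
have gF : @tofrac {poly F} (gcdp (num (repr r)) (den (repr r))) != 0.
  by rewrite tofrac_eq0.
apply: (etrans E).
by rewrite -[RHS]mulr1 -(divff gF) mulf_div -!tofracM -gn -gd.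
Qed.


Lemma revalP (n d : {poly F}) r a :
  r = @tofrac {poly F} n / @tofrac {poly F} d -> d.[a] != 0 ->
  ~~ is_pole r a /\ reval r a = n.[a] / d.[a].
Proof.
move=> rE da; have d0 : d != 0 by apply: contraNneq da => ->; rewrite horner0.
have E : rnum r * d = n * rden r.
  apply/eqP; rewrite -tofrac_eq !tofracM -eqr_div ?tofrac_eq0 ?rden_neq0 //.
  by rewrite -rE -fraction_reduced.
have rd : rden r %| d.
  have cp : coprimep (rden r) (rnum r) by rewrite coprimep_sym coprime_rnum_rden.
  by rewrite -(Gauss_dvdpr _ cp) E dvdp_mull.
have np : ~~ is_pole r a.
  by rewrite /is_pole; apply: contraNN da; rewrite -[_ == 0]/(root d a) -!dvdp_XsubCl;
    move/dvdp_trans; apply.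
split=> //; apply/eqP; rewrite eqr_div //.
by rewrite -!hornerM E.
Qed.

Lemma is_poleN r a : ~~ is_pole r a ->
  exists n d : {poly F},
    d.[a] != 0 /\ r = @tofrac {poly F} n / @tofrac {poly F} d.
Proof.
by move=> np; exists (rnum r), (rden r); split=> //; exact: fraction_reduced.
Qed.

End RationalFunctions.

Section hfun.
Variable R : realType.

(* The sub-tuple s_a, ..., s_b of s = (s_1, s_2, ...), empty if b < a. *)
Definition slice (s : seq R) (a b : nat) : seq R :=
  [seq nth 0 s j.-1 | j <- index_iota a b.+1].

Local Notation "x %:F" := (@tofrac {poly R} x).

(* [fuel] only makes the recursion on I structural; see the equations below. *)
Fixpoint hrec (fuel I : nat) (ks ls : seq R) : {fraction {poly R}} :=
  if fuel is fuel'.+1 then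
    if ~~ odd I then 0
    else if I == 1%N then ((nth 0 ks 0)%:P - 'X)%:F^-1
    else let P := I.+1./2 in
      ((\sum_(k <- ks) k - \sum_(l <- ls) l)%:P - 'X)%:F^-1 *
      \sum_(m < I)
        hrec fuel' m (slice ks 1 m.+1./2) (slice ls 1 m.-1./2) *
        hrec fuel' (I.-1 - m) (slice ks m.+3./2 P) (slice ls m.+1./2 (P - 2))
  else 0.

(* h_I (eta; ks; ls) as a rational function of eta = 'X *)
Definition hfun (I : nat) (ks ls : seq R) : {fraction {poly R}} :=
  hrec I.+1 I ks ls.

Lemma hrec_fuel n1 n2 I ks ls :
  (I < n1)%N -> (I < n2)%N -> hrec n1 I ks ls = hrec n2 I ks ls.
Proof.
elim: n1 n2 I ks ls => [//|n1 IH] [//|n2] I ks ls; rewrite !ltnS => h1 h2 /=.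
case: ifP => // Io; case: ifP => // I1; congr (_ * _).
apply: eq_bigr => m _; have mI := ltn_ord m.
have I0 : (I.-1 < I)%N by rewrite prednK // (leq_ltn_trans (leq0n m) mI).
have Ir : (I.-1 - m < I)%N by apply: leq_ltn_trans (leq_subr _ _) I0.
by congr (_ * _); apply: IH; apply: leq_trans; eassumption.
Qed.

Lemma hfun_even I ks ls : ~~ odd I -> hfun I ks ls = 0.
Proof. by rewrite /hfun /= => ->. Qed.

Lemma hfun1 k : hfun 1 [:: k] [::] = (k%:P - 'X)%:F^-1.
Proof. by []. Qed.

Lemma hfun_odd I ks ls (P := I.+1./2) : odd I -> (3 <= I)%N ->
  hfun I ks ls =
    ((\sum_(k <- ks) k - \sum_(l <- ls) l)%:P - 'X)%:F^-1 *
    \sum_(m < I)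
      hfun m (slice ks 1 m.+1./2) (slice ls 1 m.-1./2) *
      hfun (I.-1 - m) (slice ks m.+3./2 P) (slice ls m.+1./2 (P - 2)).
Proof.
move=> Io I3; rewrite {1}/hfun [LHS]/= Io /= ifF; last by case: I I3 {Io P} => [|[]].
congr (_ * _); apply: eq_bigr => m _; have mI := ltn_ord m.
have I0 : (I.-1 < I)%N by rewrite prednK // (leq_ltn_trans (leq0n m) mI).
by congr (_ * _); apply: hrec_fuel => //; apply: leq_ltn_trans (leq_subr _ _) I0.
Qed.

(* |h_I(eta; phi_k; phi_l) prod c_k prod conj(c_l)|, which is 0 when the product
   of coefficients vanishes and +oo when h_I has a pole at eta otherwise. *)
Definition hterm (c : nat -> R[i]) (phi : nat -> R) (eta : R) (I : nat)
    (ks ls : seq nat) : \bar R :=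
  let C := \prod_(k <- ks) c k * \prod_(l <- ls) conjc (c l) in
  let h := hfun I (map phi ks) (map phi ls) in
  if C == 0 then 0%E
  else if is_pole h eta then +oo%E
  else (normc ((reval h eta)%:C * C))%:E.

End hfun.

(* Main.v *)
Require Import Defs.
From mathcomp Require Import all_boot all_order all_algebra.
From mathcomp.real_closed Require Import complex.
From mathcomp Require Import all_classical all_reals all_analysis.
From mathcomp Require Import fraction zify ring lra.

Set Implicit Arguments.
Unset Strict Implicit.
Unset Printing Implicit Defensive.

Import Order.TTheory GRing.Theory Num.Theory.
Import numFieldNormedType.Exports.
Import ComplexField.Normc.

Local Open Scope classical_set_scope.
Local Open Scope ring_scope.
Local Open Scope complex_scope.

(* The Dirac equation preserves the su(1,1) structure: with a = |U_1|^2 + |U_2|^2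
   and b = U_2 conj U_1 one has a' = 4 Re(i phi b) and b' = i eta b - i conj(phi) a,
   and if r, |r| <= 1/2, solves the Riccati equation
   r' = - i eta r + i phi + i conj(phi) r^2, then
   G = ((1 + |r|^2) a - 4 Re(r b)) / (1 - |r|^2), which is comparable to a, is constant.
   Solving the Riccati equation by successive approximations, for phi a sum of
   exponentials with constant coefficients z_k, gives - r as the sum over odd I of
   the sums of h_I(eta) prod z_k prod conj z_l: the recursion of h_I says precisely
   that differentiating the term of order I produces the quadratic terms of lower
   order.  Stopping at I = p - 2 leaves an error of order p in the z's.

   Every gamma_k is replaced on [m, m+1] by the constant gamma_k(m).  The cost is
   bounded by the variation of gamma_k on [m, m+1], both in the equation inside the
   interval and in the jumps of r at the integers; the error of order p is summable
   over m because of the L^p bound.  Hence log G has bounded total increase.  Only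
   finitely many k enter r, their number depending on the time up to which U is
   estimated, so that the tail of sum c_k contributes a bounded amount. *)

(** * Absolutely continuous functions *)

(** Two obstacles shape the estimates. The [gamma k] have only bounded variation, so a series with
    coefficients [c k * gamma k x] cannot be differentiated term by term; with frozen coefficients
    [r] is a trigonometric polynomial, at the price of a jump at each integer. And the constants
    must not depend on the finite set of indices kept, since it grows with the time: they come from
    the infinite sums of condition 4. One majorant serves both ends. For each k a summable sequence
    [y k m] dominates the increments of [gamma k] to the first power and its sampled values to the
    power p. Freezing error, jump and truncation error are then all linear in [y], and weighting by
    the coefficients gives one sequence [d m] of bounded partial sums, a multiple of which bounds
    the growth of log G per step, up to the tail of the coefficients. The bound |r| <= 1/2 also
    comes from smallness of [d m], hence only from some m0 on; before that, the potential being
    bounded, Gronwall's inequality is run backwards. *)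

Section AbsoluteContinuity.
Variable R : realType.
Implicit Types (a b : R) (f g F : R -> R).

(** Compactness of a segment in additive form: the supremum of the points reachable from [a] can be
    overshot by the local property at that supremum, unless [b] is reached. *)
Lemma cousin (P : R -> R -> Prop) a b : a <= b ->
    (forall u w v, a <= u -> u <= w -> w <= v -> v <= b ->
       P u w -> P w v -> P u v) ->
    (forall x, a <= x <= b -> exists2 d : R, 0 < d &
       forall u v, a <= u -> u <= x -> x <= v -> v <= b ->
         x - d < u -> v < x + d -> P u v) ->
  P a b.
Proof.
move=> ab Padd Ploc; pose S := [set x | a <= x <= b /\ P a x].
have Sa : S a.
  split; first by rewrite lexx ab.
  by have [|d d0] := Ploc a; [rewrite lexx ab|apply; lra].
have supS : has_sup S by split; [exists a|exists b => x [/andP[]]].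
have aS : a <= sup S by apply: sup_upper_bound.
have Sb : sup S <= b by apply: ge_sup; [exists a|move=> x [/andP[]]].
have [|d d0 Pd] := Ploc (sup S); first by rewrite aS Sb.
have [x [/andP[ax xb] Pax] sx] := sup_adherent d0 supS.
have xS : x <= sup S by apply: sup_upper_bound => //; split; [rewrite ax xb|].
pose y := Num.min b (sup S + d / 2).
have yb : y <= b by rewrite ge_min lexx.
have Sy : sup S <= y by rewrite le_min Sb; lra.
have yd : y < sup S + d by rewrite gt_min; apply/orP; right; lra.
have Pay : P a y by apply: (Padd a x y) => //; [lra | apply: Pd].
have : y <= sup S.
  by apply: sup_upper_bound => //; split=> //; apply/andP; split=> //; lra.
rewrite /y; case: (leP b (sup S + d / 2)) => [h|h]; last by lra.
by move=> _; move: Pay; rewrite /y min_l.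
Qed.

(** Real-valued form of [loc_abs_cont] on one segment; complex functions enter through their real
    and imaginary parts. *)
Definition acont a b f := forall e : R, 0 < e -> exists2 d : R, 0 < d &
  forall (n : nat) (x y : nat -> R),
    (forall i, (i < n)%N -> [/\ a <= x i, x i <= y i & y i <= b]) ->
    trivIset `I_n (fun i => `]x i, y i[%classic) ->
    \sum_(i < n) (y i - x i) < d ->
    \sum_(i < n) `|f (y i) - f (x i)| < e.

Lemma lipschitz_acont a b f (k : R) :
  (forall x y, a <= x -> x <= y -> y <= b -> `|f y - f x| <= k * (y - x)) ->
  acont a b f.
Proof.
move=> fk e e0; have k0 : 0 < `|k| + 1 by rewrite ltr_wpDl.
exists (e / (`|k| + 1)); first exact: divr_gt0.
move=> n x y xy _; rewrite ltr_pdivlMr// mulrC => /(le_lt_trans _); apply.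
rewrite mulr_sumr; apply: ler_sum => i _; have [ax xyi yb] := xy i (ltn_ord i).
apply: le_trans (fk _ _ ax xyi yb) _; rewrite ler_wpM2r ?subr_ge0//.
by rewrite (le_trans (ler_norm _))// lerDl.
Qed.

Lemma acont_cst a b (k : R) : acont a b (fun=> k).
Proof. by apply: (@lipschitz_acont _ _ _ 0) => x y *; rewrite subrr normr0 mul0r. Qed.

Lemma acontD a b f g : acont a b f -> acont a b g -> acont a b (fun x => f x + g x).
Proof.
move=> fac gac e e0; have e2 : 0 < e / 2 by lra.
have [d d0 fd] := fac _ e2; have [d' d'0 gd] := gac _ e2.
exists (Num.min d d'); first by rewrite lt_min d0.
move=> n x y xy tI; rewrite lt_min => /andP[hd hd'].
rewrite [ltRHS]splitr (le_lt_trans _ (ltrD (fd n x y xy tI hd) (gd n x y xy tI hd')))//.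
rewrite -big_split; apply: ler_sum => i _; rewrite opprD addrACA; exact: ler_normD.
Qed.

Lemma acontN a b f : acont a b f -> acont a b (fun x => - f x).
Proof.
move=> fac e /fac[d d0 fd]; exists d => // n x y xy tI hd.
rewrite (le_lt_trans _ (fd n x y xy tI hd))//; apply: ler_sum => i _.
by rewrite -opprD normrN.
Qed.

(* A uniformly continuous function on a segment stays within one unit of its
   value at the previous point of a subdivision. *)
Lemma acont_bounded a b f : acont a b f ->
  exists2 M : R, 0 <= M & forall x, a <= x <= b -> `|f x| <= M.
Proof.
move=> fac; have [|ab] := ltP b a.
  by move=> ba; exists 0 => // x /andP[? ?]; lra.
have [d d0 fd] := fac 1 ltr01.
pose P u v := exists M : R, forall x, u <= x <= v -> `|f x| <= M.
have [M HM] : P a b.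
  apply: (@cousin P) => // [u w v au uw wv vb [M1 H1] [M2 H2]|x /andP[ax xb]].
    exists (Num.max M1 M2) => x /andP[ux xv]; rewrite le_max.
    by have [xw|wx] := leP x w; apply/orP; [left; apply: H1|right; apply: H2]; lra.
  exists d => // u v au ux xv vb hu hv; exists (`|f x| + 1) => t /andP[ut tv].
  have [xt|tx] := leP x t.
    have := fd 1%N (fun=> x) (fun=> t); rewrite !big_ord1 => H.
    have : `|f t - f x| < 1.
      apply: H => [i _| |]; [by split; lra| |lra].
      by move=> [|i] [|j].
    by move=> H1; rewrite -(subrK (f x) (f t)) (le_trans (ler_normD _ _))//; lra.
  have := fd 1%N (fun=> t) (fun=> x); rewrite !big_ord1 => H.
  have : `|f x - f t| < 1.
    apply: H => [i _| |]; [by split; lra| |lra].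
    by move=> [|i] [|j].
  rewrite distrC => H1; rewrite -(subrK (f x) (f t)) (le_trans (ler_normD _ _))//; lra.
exists M => //; apply: le_trans (HM a _); last by rewrite lexx ab.
exact: normr_ge0.
Qed.

Lemma acontM a b f g : acont a b f -> acont a b g -> acont a b (fun x => f x * g x).
Proof.
move=> fac gac; have [M M0 fM] := acont_bounded fac; have [N N0 gN] := acont_bounded gac.
move=> e e0; have eM : 0 < e / 2 / (M + N + 1) by rewrite !divr_gt0//; lra.
have [d d0 fd] := fac _ eM; have [d' d'0 gd] := gac _ eM.
exists (Num.min d d'); first by rewrite lt_min d0.
move=> n x y xy tI; rewrite lt_min => /andP[hd hd'].
have := fd n x y xy tI hd; have := gd n x y xy tI hd'.
set A := \sum_(i < n) `|g _ - _|; set B := \sum_(i < n) _; set q := e / 2 / _.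
move=> Aq Bq; apply: (@le_lt_trans _ _ (M * A + N * B)).
  rewrite !mulr_sumr -big_split; apply: ler_sum => i _ /=.
  have [ax xyi yb] := xy i (ltn_ord i).
  have -> : f (y i) * g (y i) - f (x i) * g (x i) =
    f (y i) * (g (y i) - g (x i)) + g (x i) * (f (y i) - f (x i)) by ring.
  rewrite (le_trans (ler_normD _ _))// !normrM lerD// ler_wpM2r//.
    by apply: fM; lra.
  by apply: gN; lra.
have q0 : 0 <= q by apply: ltW.
have -> : e = 2 * (M + N + 1) * q by rewrite /q; field; lra.
have : M * A <= M * q by rewrite ler_wpM2l// ltW.
have : N * B <= N * q by rewrite ler_wpM2l// ltW.
have : 0 < (M + N + 2) * q by rewrite mulr_gt0//; lra.
nra.
Qed.

Lemma acontV a b f (m : R) : 0 < m -> (forall x, a <= x <= b -> m <= f x) ->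
  acont a b f -> acont a b (fun x => (f x)^-1).
Proof.
move=> m0 fm fac e e0; have em : 0 < e * m ^+ 2 by rewrite mulr_gt0// exprn_gt0.
have [d d0 fd] := fac _ em; exists d => // n x y xy tI hd.
have m20 : 0 < m ^+ 2 by rewrite exprn_gt0.
have := fd n x y xy tI hd; rewrite -ltr_pdivrMr//; apply: le_lt_trans.
rewrite mulr_suml; apply: ler_sum => i _; have [ax xyi yb] := xy i (ltn_ord i).
have fx : m <= f (x i) by apply: fm; lra.
have fy : m <= f (y i) by apply: fm; lra.
have -> : (f (y i))^-1 - (f (x i))^-1 = - (f (y i) - f (x i)) / (f (y i) * f (x i)).
  by field; apply/andP; split; apply: lt0r_neq0; lra.
rewrite normrM normrN normfV ler_wpM2l// lef_pV2 ?posrE//; last first.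
  by rewrite normr_gt0 mulf_neq0//; apply: lt0r_neq0; lra.
rewrite gtr0_norm ?mulr_gt0 ?(lt_le_trans m0)// expr2 ler_pM//; lra.
Qed.

(** The slope over an interval straddling [x] is an average of the slopes on its two sides, so
    differentiability at the single point [x] suffices. This is the local property that [cousin]
    asks for. *)
Lemma derive_secant_le F (x l e : R) : is_derive x 1 F l -> 0 < e ->
  exists2 d : R, 0 < d & forall u v, u <= x -> x <= v -> x - d < u -> v < x + d ->
    F v - F u <= (l + e) * (v - u).
Proof.
move=> [dF lF] e0; move: lF; rewrite /derive => lF.
have cF : (fun h : R => h^-1 *: (F (h *: 1 + x) - F x)) @ 0^' --> l.
  by rewrite -lF; exact: dF.
have /cvgrPdist_le /(_ e e0) := cF.
rewrite /dnbhs /= near_withinE near_simpl -nearE => /nbhs_ballP[d /= d0 Hd].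
exists d => // u v ux xv ud vd.
have H h : h != 0 -> `|h| < d -> `|l - h^-1 * (F (h + x) - F x)| <= e.
  move=> h0 hd; have := Hd h; rewrite /ball /= sub0r normrN => /(_ hd h0).
  by rewrite /GRing.scale /= mulr1.
have Hv : F v - F x <= (l + e) * (v - x).
  have [->|vx] := eqVneq v x; first by rewrite !subrr mulr0.
  have h0 : 0 < v - x by rewrite subr_gt0 lt_neqAle eq_sym vx.
  have := H (v - x); rewrite gt_eqF// gtr0_norm// subrK => /(_ isT).
  have dd : v - x < d by lra.
  move=> /(_ dd); rewrite distrC => /(le_trans (ler_norm _)).
  by rewrite lerBlDl mulrC ler_pdivrMr.
have Hu : F x - F u <= (l + e) * (x - u).
  have [->|vx] := eqVneq x u; first by rewrite !subrr mulr0.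
  have h0 : 0 < x - u by rewrite subr_gt0 lt_neqAle eq_sym vx.
  have := H (u - x); rewrite -(opprB x u) oppr_eq0 gt_eqF// normrN gtr0_norm// opprB subrK.
  move=> /(_ isT); have dd : x - u < d by lra.
  move=> /(_ dd); rewrite distrC => /(le_trans (ler_norm _)).
  by rewrite -(opprB x u) invrN mulNr -mulrN opprB lerBlDl mulrC ler_pdivrMr.
nra.
Qed.

End AbsoluteContinuity.

Section Monotonicity.
Variable R : realType.
Implicit Types (a b : R) (F : R -> R).
Local Notation mu := (@lebesgue_measure R).

Lemma sum_itv_lengths_le (U : set R) (n : nat) (x y : nat -> R) : measurable U ->
    (forall i, (i < n)%N -> x i <= y i /\ `]x i, y i[%classic `<=` U) ->
    trivIset `I_n (fun i => `]x i, y i[%classic) ->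
  ((\sum_(i < n) (y i - x i))%:E <= mu U)%E.
Proof.
move=> mU xyU tI.
have -> : ((\sum_(i < n) (y i - x i))%:E = \sum_(i < n) mu `]x i, y i[%classic)%E.
  rewrite -sumEFin; apply: eq_bigr => i _; rewrite lebesgue_measure_itv /= lte_fin.
  have [xy _] := xyU i (ltn_ord i); case: (ltP (x i) (y i)) => // yx.
  by have -> : y i = x i; [lra|rewrite subrr].
have mI i : measurable `]x i, y i[%classic by exact: measurable_itv.
have tI' : trivIset [set: 'I_n] (fun i : 'I_n => `]x i, y i[%classic).
  by move=> i j _ _ h; apply: val_inj; apply: tI => //=.
rewrite -(@measure_bigsetU_ord _ _ _ mu n xpredT (fun i : 'I_n => `]x i, y i[%classic)) //.
apply: le_measure; rewrite ?inE //; first exact: bigsetU_measurable.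
rewrite -(bigcup_mkord n (fun i => `]x i, y i[%classic)) => t [i /= /xyU[_ +]]; exact.
Qed.

(* Outside a null set the increments are controlled by the derivative; the null
   set is covered by an open set of small measure, on which absolute continuity
   controls the increments. *)
Lemma acont_le_of_derive a b F (N : set R) : a <= b -> acont a b F ->
    mu.-negligible N ->
    (forall x, a <= x <= b -> ~ N x -> exists2 l : R, is_derive x 1 F l & l <= 0) ->
  F b <= F a.
Proof.
move=> ab Fac [A [mA A0 NA]] dF.
suff H (e : R) : 0 < e -> F b - F a <= e * (b - a) + e.
  rewrite -subr_le0; apply/ler_addgt0Pr => e e0; rewrite add0r.
  have q0 : 0 < e / (b - a + 1) by rewrite divr_gt0//; lra.
  apply: le_trans (H _ q0) _.
  by have -> : e / (b - a + 1) * (b - a) + e / (b - a + 1) = e by field; lra.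
(* The [d] of absolute continuity is fixed first, and the open cover of the null set is then taken
   of measure less than [d]. *)
move=> e0; have [d d0 Fd] := Fac e e0.
have fA : (mu A < +oo)%E by rewrite A0 ltry.
have [U [oU AU UA]] := lebesgue_regularity_outer mA fA d0.
have mU : measurable U by exact: measurable_realfun.open_measurable.
have Ud : (mu U < d%:E)%E.
  have -> : (mu U = mu A + mu (U `\` A))%E.
    by rewrite -{1}(setDUK AU) measureU ?setDIK//; exact: measurableD.
  by rewrite A0 add0e.
(* Increment at most [e] times the length, up to the increments over finitely many disjoint
   intervals inside [U]. Such families concatenate, which makes the property additive. *)
pose P u v := exists n (x y : nat -> R),
  [/\ forall i, (i < n)%N -> [/\ u <= x i, x i <= y i & y i <= v],
      forall i, (i < n)%N -> `]x i, y i[%classic `<=` U,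
      trivIset `I_n (fun i => `]x i, y i[%classic) &
      F v - F u <= e * (v - u) + \sum_(i < n) `|F (y i) - F (x i)|].
have [n [x [y [xy xyU tI Fba]]]] : P a b.
  apply: (@cousin R P) => //.
    move=> u w v au uw wv vb [n [x [y [xy xyU tI Fwu]]]] [m [x' [y' [xy' xyU' tI' Fvw]]]].
    exists (n + m)%N, (fun i => if (i < n)%N then x i else x' (i - n)%N),
      (fun i => if (i < n)%N then y i else y' (i - n)%N); split.
    - move=> i inm; case: ifP => [/xy[? ? ?]|/negbT]; first by split; lra.
      rewrite -leqNgt => ni; have /xy'[? ? ?] : (i - n < m)%N by rewrite ltn_subLR.
      by split; lra.
    - move=> i inm; case: ifP => [/xyU//|/negbT]; rewrite -leqNgt => ni.
      by apply: xyU'; rewrite ltn_subLR.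
    - move=> i j /= inm jnm [t []] /=.
      case: ltnP => hi; case: ltnP => hj; rewrite /= !in_itv /= => /andP[h1 h2] /andP[h3 h4].
      + by apply: tI => //; exists t; split; rewrite /= in_itv /= ?h1 ?h3.
      + have [_ _ ?] := xy i hi.
        by have [] := xy' (j - n)%N; [rewrite ltn_subLR|move=> *; exfalso; lra].
      + have [_ _ ?] := xy j hj.
        by have [] := xy' (i - n)%N; [rewrite ltn_subLR|move=> *; exfalso; lra].
      + have : (i - n)%N = (j - n)%N.
          apply: tI'; rewrite /= ?ltn_subLR//.
          by exists t; split; rewrite /= in_itv /= ?h1 ?h3.
        by move/(congr1 (addn n)); rewrite !subnKC.
    - rewrite big_split_ord /=.
      have -> : \sum_(i < n) `|F (if (i < n)%N then y i else y' (i - n)%N) -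
            F (if (i < n)%N then x i else x' (i - n)%N)| =
          \sum_(i < n) `|F (y i) - F (x i)|.
        by apply: eq_bigr => i _; rewrite ltn_ord.
      have -> : \sum_(i < m) `|F (if (n + i < n)%N then y (n + i)%N else y' (n + i - n)%N) -
            F (if (n + i < n)%N then x (n + i)%N else x' (n + i - n)%N)| =
          \sum_(i < m) `|F (y' i) - F (x' i)|.
        by apply: eq_bigr => i _; rewrite ltnNge leq_addr /= addKn.
      lra.
  (* Near a point of the null set the whole interval joins the exceptional family; near any other
     point the derivative gives the bound with an empty family. *)
  move=> x xab; have [Ax|nAx] := pselect (A x).
    have /nbhs_ballP[r /= r0 rU] : nbhs x U by apply: open_nbhs_nbhs; split => //; exact: AU.
    exists r => // u v au ux xv vb xu vx; exists 1%N, (fun=> u), (fun=> v); split.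
    - by move=> _ _; split; lra.
    - move=> _ _ t /=; rewrite in_itv /= => /andP[ut tv]; apply: rU.
      by rewrite /ball /= ltr_norml; apply/andP; split; lra.
    - by move=> [|i] [|j].
    - rewrite big_ord1; apply: le_trans (ler_norm _) _; rewrite lerDr mulr_ge0//; lra.
  have [|l dl l0] := dF x xab; first by move/NA.
  have [r r0 Hr] := derive_secant_le dl e0; exists r => // u v au ux xv vb xu vx.
  exists 0%N, (fun=> u), (fun=> v); split; [by []|by []|by move=> i j /=|].
  rewrite big_ord0 addr0; apply: le_trans (Hr _ _ ux xv xu vx) _.
  by rewrite ler_wpM2r//; lra.
have ltd : \sum_(i < n) (y i - x i) < d.
  rewrite -lte_fin; apply: le_lt_trans Ud; apply: sum_itv_lengths_le => //.
  by move=> i hi; have [] := xy i hi; split; last exact: xyU.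
have := Fd n x y xy tI ltd; lra.
Qed.

End Monotonicity.

Section DeriveRules.
Variable R : realType.
Implicit Types (a b x df dg k : R) (f g : R -> R).

Lemma is_derive_addf f g x df dg : is_derive x 1 f df -> is_derive x 1 g dg ->
  is_derive x 1 (fun t => f t + g t) (df + dg).
Proof. exact: is_deriveD. Qed.

Lemma is_derive_oppf f x df : is_derive x 1 f df -> is_derive x 1 (fun t => - f t) (- df).
Proof. exact: is_deriveN. Qed.

Lemma is_derive_mulf f g x df dg : is_derive x 1 f df -> is_derive x 1 g dg ->
  is_derive x 1 (fun t => f t * g t) (df * g x + f x * dg).
Proof.
move=> hf hg; have := is_deriveM hf hg.
by rewrite /GRing.scale /= addrC (mulrC df).
Qed.

Lemma is_derive_cstf k x : is_derive x 1 (fun=> k) 0.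
Proof. exact: is_derive_cst. Qed.

Lemma is_derive_linear k x : is_derive x 1 (fun t : R => k * t) k.
Proof.
by have := is_derive_mulf (is_derive_cstf k x) (is_derive_id x 1); rewrite mul0r add0r mulr1.
Qed.

Lemma is_derive_invf f x df : f x != 0 -> is_derive x 1 f df ->
  is_derive x 1 (fun t => (f t)^-1) (- df / f x ^+ 2).
Proof.
move=> fx hf; have := @is_deriveV _ f x df 1 fx hf.
by rewrite /GRing.scale /= !mulNr mulrC.
Qed.

Lemma is_derive_cosM k x : is_derive x 1 (fun t : R => cos (k * t)) (- k * sin (k * x)).
Proof.
apply: is_derive_eq (@is_derive1_comp _ cos (fun t => k * t) x _ _ _ (is_derive_linear k x)) _.
by rewrite !mulNr mulrC.
Qed.

Lemma is_derive_sinM k x : is_derive x 1 (fun t : R => sin (k * t)) (k * cos (k * x)).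
Proof.
apply: is_derive_eq (@is_derive1_comp _ sin (fun t => k * t) x _ _ _ (is_derive_linear k x)) _.
by rewrite mulrC.
Qed.

Lemma is_derive_expRM k x : is_derive x 1 (fun t : R => expR (k * t)) (k * expR (k * x)).
Proof.
apply: is_derive_eq (@is_derive1_comp _ expR (fun t => k * t) x _ _ _ (is_derive_linear k x)) _.
by rewrite mulrC.
Qed.

Lemma bounded_derive_acont a b f (df : R -> R) k :
  (forall x, is_derive x 1 f (df x)) -> (forall x, a <= x <= b -> `|df x| <= k) ->
  acont a b f.
Proof.
move=> hf hk; apply: (@lipschitz_acont _ _ _ _ k) => x y ax xy yb.
have [|c /itvP cxy ->] := @MVT_segment R f df x y xy (fun t _ => hf t).
  by apply: derivable_within_continuous => t _; exact: ex_derive.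
rewrite normrM (ger0_norm (_ : 0 <= y - x)) ?subr_ge0// ler_wpM2r ?subr_ge0//.
by apply: hk; rewrite (le_trans ax) ?cxy// (le_trans _ yb) ?cxy.
Qed.

Lemma acont_cosM a b k : acont a b (fun t : R => cos (k * t)).
Proof.
apply: (bounded_derive_acont (is_derive_cosM k) (k := `|k|)) => x _.
by rewrite normrM normrN ler_piMr// ler_norml sin_geN1 sin_le1.
Qed.

Lemma acont_sinM a b k : acont a b (fun t : R => sin (k * t)).
Proof.
apply: (bounded_derive_acont (is_derive_sinM k) (k := `|k|)) => x _.
by rewrite normrM ler_piMr// ler_norml cos_geN1 cos_le1.
Qed.

Lemma acont_expRM a b k : acont a b (fun t : R => expR (k * t)).
Proof.
apply: (bounded_derive_acont (is_derive_expRM k) (k := `|k| * expR (`|k| * Num.max `|a| `|b|))).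
move=> x /andP[ax xb]; rewrite normrM ler_wpM2l// ger0_norm ?expR_ge0// ler_expR.
apply: le_trans (ler_norm _) _; rewrite normrM ler_wpM2l// le_max.
case: (leP 0 x) => x0.
  by apply/orP; right; rewrite ger0_norm// (le_trans xb)// ler_norm.
by apply/orP; left; rewrite ltr0_norm// -normrN (le_trans _ (ler_norm (- a)))// lerN2.
Qed.

Local Notation mu := (@lebesgue_measure R).

(** The integrating factor works for any sign of [k] and of [f]; with [- f] and a negative [k] the
    same statement runs backwards in time. *)
Lemma acont_gronwall a b k f (N : set R) : a <= b -> acont a b f -> mu.-negligible N ->
    (forall x, a <= x <= b -> ~ N x -> exists2 l : R, is_derive x 1 f l & l <= k * f x) ->
  f b <= expR (k * (b - a)) * f a.
Proof.
move=> ab fac N0 df.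
have : f b * expR (- k * b) <= f a * expR (- k * a).
  apply: (@acont_le_of_derive _ a b (fun t => f t * expR (- k * t)) N) => //.
    exact: (acontM fac (acont_expRM a b (- k))).
  move=> x xab Nx; have [l dl lk] := df x xab Nx.
  exists ((l - k * f x) * expR (- k * x)); last first.
    by rewrite pmulr_lle0 ?expR_gt0// subr_le0.
  apply: is_derive_eq (is_derive_mulf dl (is_derive_expRM (- k) x)) _.
  by ring.
rewrite -(ler_pM2r (expR_gt0 (k * b))) -!mulrA -!expRD mulNr addNr expR0 mulr1.
by rewrite mulrC mulNr addrC -mulrBr.
Qed.

End DeriveRules.

(** * The quadratic form and the Riccati equation *)

Section Lyapunov.
Variable R : realType.
Implicit Types a b k d r : R.

Lemma sqr_le_norm (x y : R) : 0 <= y -> x ^+ 2 <= y ^+ 2 -> `|x| <= y.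
Proof. by move=> y0; rewrite -(real_normK (num_real x)) ler_pXn2r ?nnegrE. Qed.

Lemma cauchy_schwarz2 (x1 x2 y1 y2 X Y : R) : 0 <= X -> 0 <= Y ->
  x1 ^+ 2 + x2 ^+ 2 <= X ^+ 2 -> y1 ^+ 2 + y2 ^+ 2 <= Y ^+ 2 ->
  `|x1 * y1 + x2 * y2| <= X * Y.
Proof.
move=> X0 Y0 hX hY; apply: sqr_le_norm; first exact: mulr_ge0.
rewrite exprMn; apply: (@le_trans _ _ ((x1 ^+ 2 + x2 ^+ 2) * (y1 ^+ 2 + y2 ^+ 2))).
  rewrite -subr_ge0.
  have -> : (x1 ^+ 2 + x2 ^+ 2) * (y1 ^+ 2 + y2 ^+ 2) - (x1 * y1 + x2 * y2) ^+ 2 =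
    (x1 * y2 - x2 * y1) ^+ 2 by ring.
  exact: sqr_ge0.
by apply: ler_pM => //; rewrite addr_ge0 ?sqr_ge0.
Qed.

(* With [a = |V_1|^2 + |V_2|^2], [b = V_2 * conj V_1] and [r = r1 + i r2] this is
   the squared norm of [(V_1 - r V_2, V_2 - conj r V_1) / sqrt (1 - |r|^2)], the
   image of [V] under an element of SU(1,1). *)
Definition lyap a b1 b2 r1 r2 : R :=
  ((1 + (r1 ^+ 2 + r2 ^+ 2)) * a - 4 * (r1 * b1 - r2 * b2)) /
  (1 - (r1 ^+ 2 + r2 ^+ 2)).

Lemma lyap_bounds a b1 b2 r1 r2 : 0 <= a -> 4 * (b1 ^+ 2 + b2 ^+ 2) <= a ^+ 2 ->
    r1 ^+ 2 + r2 ^+ 2 <= 1 / 4 ->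
  a <= 3 * lyap a b1 b2 r1 r2 /\ lyap a b1 b2 r1 r2 <= 3 * a.
Proof.
move=> a0 hb hr; rewrite /lyap; set s := r1 ^+ 2 + _ in hr *; set X := r1 * b1 - _.
have s0 : 0 <= s by rewrite addr_ge0 ?sqr_ge0.
have X2 : (4 * X) ^+ 2 <= 4 * s * a ^+ 2.
  have : 4 * s * (4 * (b1 ^+ 2 + b2 ^+ 2)) <= 4 * s * a ^+ 2.
    by rewrite ler_wpM2l//; lra.
  apply: le_trans; rewrite -subr_ge0.
  have -> : 4 * s * (4 * (b1 ^+ 2 + b2 ^+ 2)) - (4 * X) ^+ 2 =
    16 * (r1 * b2 + r2 * b1) ^+ 2 by rewrite /s /X; ring.
  by rewrite mulr_ge0 ?sqr_ge0.
(* Since |4 X| <= 2 sqrt(s) a, both bounds below reduce after squaring to this one inequality, 1 - 5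
   s + 4 s^2 >= 0; it is what fixes the threshold |r| <= 1/2. *)
have s4 : 0 <= (1 - 4 * s) * (1 - s) by apply: mulr_ge0; lra.
have H1 : `|4 * X| <= (2 / 3 + 4 / 3 * s) * a.
  apply: sqr_le_norm; first by apply: mulr_ge0 => //; lra.
  apply: (le_trans X2); rewrite exprMn ler_wpM2r ?sqr_ge0//; nra.
have H2 : `|4 * X| <= (2 - 4 * s) * a.
  apply: sqr_le_norm; first by apply: mulr_ge0 => //; lra.
  apply: (le_trans X2); rewrite exprMn ler_wpM2r ?sqr_ge0//; nra.
move: H1 H2; rewrite !ler_norml => /andP[_ H1] /andP[H2 _].
have D0 : 0 < 1 - s by lra.
split; first by rewrite mulrA ler_pdivlMr//; nra.
by rewrite ler_pdivrMr//; nra.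
Qed.

Lemma lyap_jump a b1 b2 r1 r2 r1' r2' d : 0 <= a -> 4 * (b1 ^+ 2 + b2 ^+ 2) <= a ^+ 2 ->
    0 <= d -> r1 ^+ 2 + r2 ^+ 2 <= 1 / 4 -> r1' ^+ 2 + r2' ^+ 2 <= 1 / 4 ->
    (r1 - r1') ^+ 2 + (r2 - r2') ^+ 2 <= d ^+ 2 ->
  lyap a b1 b2 r1 r2 <= (1 + 27 * d) * lyap a b1 b2 r1' r2'.
Proof.
move=> a0 hb d0 hr hr' hd; have [hG _] := lyap_bounds a0 hb hr'.
(* Over the common denominator the numerator is at most [5 * d * a] and the denominator at least
   9/16, whence 9; the comparison [a <= 3 * lyap] turns it into 27. *)
suff : lyap a b1 b2 r1 r2 - lyap a b1 b2 r1' r2' <= 9 * d * a.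
  have : 9 * d * a <= 9 * d * (3 * lyap a b1 b2 r1' r2').
    by rewrite ler_wpM2l// mulr_ge0.
  lra.
have a2 : 0 <= a / 2 by lra.
have hb2 : b1 ^+ 2 + (- b2) ^+ 2 <= (a / 2) ^+ 2 by rewrite sqrrN expr_div_n; lra.
have half2 : 1 / 4 = (1 / 2 : R) ^+ 2 by field.
have := cauchy_schwarz2 d0 a2 hd hb2.
have := @cauchy_schwarz2 _ _ _ _ (1 / 2) (a / 2) _ a2 _ hb2; move=> /(_ r1' r2').
rewrite -half2 => /(_ _ hr'); have h12 : 0 <= 1 / 2 :> R by lra.
move=> /(_ h12).
have h1 : 0 <= 1 :> R by [].
have hsum : (r1 + r1') ^+ 2 + (r2 + r2') ^+ 2 <= 1 ^+ 2.
  have : 0 <= (r1 - r1') ^+ 2 + (r2 - r2') ^+ 2 by rewrite addr_ge0 ?sqr_ge0.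
  nra.
have := cauchy_schwarz2 d0 h1 hd hsum.
rewrite /lyap; set s := r1 ^+ 2 + _ in hr *; set s' := r1' ^+ 2 + _ in hr' *.
have -> : (r1 - r1') * (r1 + r1') + (r2 - r2') * (r2 + r2') = s - s'.
  by rewrite /s /s'; ring.
have -> : r1' * b1 + r2' * - b2 = r1' * b1 - r2' * b2 by ring.
have -> : (r1 - r1') * b1 + (r2 - r2') * - b2 =
  (r1 * b1 - r2 * b2) - (r1' * b1 - r2' * b2) by ring.
set X := r1 * b1 - _; set X' := r1' * b1 - _ => h3 h4 h5.
have s0 : 0 <= s by rewrite addr_ge0 ?sqr_ge0.
have s'0 : 0 <= s' by rewrite addr_ge0 ?sqr_ge0.
have -> : ((1 + s) * a - 4 * X) / (1 - s) - ((1 + s') * a - 4 * X') / (1 - s') =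
    (2 * (s - s') * a - 4 * ((X - X') * (1 - s') + X' * (s - s'))) / ((1 - s) * (1 - s')).
  by field; apply/andP; split; rewrite subr_eq0 eq_sym lt_eqF//; lra.
have D0 : 9 / 16 <= (1 - s) * (1 - s').
  have : 0 <= (1 - s - 3 / 4) * (1 - s' - 3 / 4) by apply: mulr_ge0; lra.
  nra.
rewrite ler_pdivrMr; last by lra.
have da : 0 <= d * a by apply: mulr_ge0.
have : 2 * (s - s') * a <= 2 * (d * a).
  rewrite -mulrA ler_pM2l// ler_wpM2r// (le_trans (ler_norm _))//; lra.
have : - ((X - X') * (1 - s')) <= d * (a / 2).
  rewrite -mulrN (le_trans (ler_norm _))// normrM -[leRHS]mulr1 ler_pM// normrN.
  by rewrite ger0_norm; lra.
have : - (X' * (s - s')) <= a / 4 * d.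
  by rewrite (le_trans (ler_norm _))// normrN normrM ler_pM//; lra.
have : 9 * d * a * (9 / 16) <= 9 * d * a * ((1 - s) * (1 - s')).
  by rewrite ler_wpM2l//; nra.
nra.
Qed.

(* The differential equations for [a], [b] are those of solutions of the Dirac
   system with potential [f = f1 + i f2]; that of [r] is the Riccati equation
   [r' = - i eta r + i f + i (conj f) r^2 - e], under which the quadratic form
   [lyap] would be constant if the error term [e] vanished. *)
Lemma lyap_derive (a b1 b2 r1 r2 : R -> R) (eta f1 f2 e1 e2 k x : R) :
    0 <= a x -> 4 * (b1 x ^+ 2 + b2 x ^+ 2) <= a x ^+ 2 ->
    r1 x ^+ 2 + r2 x ^+ 2 <= 1 / 4 ->
    0 <= k -> e1 ^+ 2 + e2 ^+ 2 <= k ^+ 2 ->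
    is_derive x 1 a (- 4 * (f1 * b2 x + f2 * b1 x)) ->
    is_derive x 1 b1 (- eta * b2 x - f2 * a x) ->
    is_derive x 1 b2 (eta * b1 x - f1 * a x) ->
    is_derive x 1 r1 (eta * r2 x - f2 + f2 * (r1 x ^+ 2 - r2 x ^+ 2)
                      - f1 * (2 * r1 x * r2 x) - e1) ->
    is_derive x 1 r2 (- eta * r1 x + f1 + f1 * (r1 x ^+ 2 - r2 x ^+ 2)
                      + f2 * (2 * r1 x * r2 x) - e2) ->
  exists2 l : R, is_derive x 1 (fun t => lyap (a t) (b1 t) (b2 t) (r1 t) (r2 t)) l
    & l <= 30 * k * lyap (a x) (b1 x) (b2 x) (r1 x) (r2 x).
Proof.
move=> a0 hb hr k0 he da db1 db2 dr1 dr2.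
have [hG _] := lyap_bounds a0 hb hr.
set s := r1 x ^+ 2 + r2 x ^+ 2.
have s0 : 0 <= s by rewrite addr_ge0 ?sqr_ge0.
have D0 : 1 - s != 0 by rewrite subr_eq0 eq_sym lt_eqF// (le_lt_trans hr)//; lra.
pose N := (1 + s) * a x - 4 * (r1 x * b1 x - r2 x * b2 x).
pose p := r1 x * e1 + r2 x * e2; pose q := e1 * b1 x + e2 * - b2 x.
(* Everything free of the error cancels in the derivative; what remains is linear in [e], through
   [p] = Re (conj r e) and [q] = Re (e b). *)
pose l := ((- 2 * p * a x + 4 * q) * (1 - s) - N * (2 * p)) / (1 - s) ^+ 2.
exists l.
  have ds : is_derive x 1 (fun t => r1 t ^+ 2 + r2 t ^+ 2) _ :=
    is_derive_addf (is_derive_mulf dr1 dr1) (is_derive_mulf dr2 dr2).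
  have dX := is_derive_addf (is_derive_mulf dr1 db1)
    (is_derive_oppf (is_derive_mulf dr2 db2)).
  have dN := is_derive_addf
    (is_derive_mulf (is_derive_addf (is_derive_cstf 1 x) ds) da)
    (is_derive_oppf (is_derive_mulf (is_derive_cstf 4 x) dX)).
  have dD := @is_derive_invf _ (fun t => 1 - (r1 t ^+ 2 + r2 t ^+ 2)) x _ D0
    (is_derive_addf (is_derive_cstf 1 x) (is_derive_oppf ds)).
  apply: is_derive_eq (is_derive_mulf dN dD) _.
  rewrite /l /N /p /q /= -/s; move: D0; rewrite /s => D0; by field.
(* The numerator of [l] is at most (3 + 9/4) k a and the denominator at least 9/16, which 10
   absorbs; the factor 3 from [a] to [lyap] then gives 30. *)
apply: (@le_trans _ _ (10 * k * a x)); last first.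
  by have : 10 * k * a x <= 10 * k * (3 * lyap (a x) (b1 x) (b2 x) (r1 x) (r2 x));
    [rewrite ler_wpM2l// mulr_ge0|lra].
have a2 : 0 <= a x / 2 by lra.
have h12 : 0 <= 1 / 2 :> R by lra.
have half2 : 1 / 4 = (1 / 2 : R) ^+ 2 by field.
have hb2 : b1 x ^+ 2 + (- b2 x) ^+ 2 <= (a x / 2) ^+ 2.
  by rewrite sqrrN expr_div_n; lra.
rewrite half2 in hr.
have := cauchy_schwarz2 h12 k0 hr he; have := cauchy_schwarz2 k0 a2 he hb2.
have := cauchy_schwarz2 h12 a2 hr hb2; rewrite -/p -/q mulrN.
set X := r1 x * b1 x - r2 x * b2 x => hX; rewrite !ler_norml => /andP[q1 q2] /andP[p1 p2].
move: hX; rewrite ler_norml => /andP[X1 X2]; rewrite -half2 -/s in hr.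
have ka : 0 <= k * a x by apply: mulr_ge0.
have N1 : 0 <= N by rewrite /N -/X; nra.
have N2 : N <= 9 / 4 * a x by rewrite /N -/X; nra.
have pa : - (1 / 2 * (k * a x)) <= p * a x by rewrite mulrA -mulNr ler_wpM2r.
have Np : - (N * (2 * p)) <= 9 / 4 * (k * a x).
  have : N * (- (2 * p)) <= N * k by rewrite ler_wpM2l//; lra.
  have : N * k <= 9 / 4 * a x * k by rewrite ler_wpM2r.
  lra.
have M0 : (- 2 * p * a x + 4 * q) * (1 - s) <= 3 * (k * a x).
  apply: (@le_trans _ _ (3 * (k * a x) * (1 - s))).
    by rewrite ler_wpM2r//; lra.
  by rewrite ler_piMr//; lra.
have DD : 9 / 16 <= (1 - s) ^+ 2.
  have : 0 <= (1 - s - 3 / 4) * (1 - s + 3 / 4) by apply: mulr_ge0; lra.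
  nra.
rewrite /l ler_pdivrMr; last by lra.
have : 10 * k * a x * (9 / 16) <= 10 * k * a x * (1 - s) ^+ 2.
  by rewrite ler_wpM2l//; lra.
lra.
Qed.

End Lyapunov.

(** * Evaluation of the functions h_I *)

Section FractionEvaluation.
Variable F : fieldType.
Implicit Types (r s : {fraction {poly F}}) (p : {poly F}) (a : F).

(** Evaluation may use any quotient whose denominator does not vanish at [a]. Hence it is additive
    and multiplicative on the functions regular at [a], and the recursion of h_I passes to
    values. *)
Lemma reval_quotient r a : ~~ is_pole r a -> exists n d : {poly F},
  [/\ d.[a] != 0, r = @tofrac {poly F} n / @tofrac {poly F} d
    & reval r a = n.[a] / d.[a]].
Proof.
move=> /is_poleN[n [d [da rE]]]; exists n, d; split=> //.
by have [] := revalP rE da.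
Qed.

Lemma reval_tofrac p a : ~~ is_pole (@tofrac {poly F} p) a /\ reval (@tofrac {poly F} p) a = p.[a].
Proof.
have := @revalP F p 1 (@tofrac {poly F} p) a.
by rewrite tofrac1 divr1 hornerC divr1 oner_neq0; apply.
Qed.

Lemma reval_add r s a : ~~ is_pole r a -> ~~ is_pole s a ->
  ~~ is_pole (r + s) a /\ reval (r + s) a = reval r a + reval s a.
Proof.
move=> /reval_quotient[n [d [da -> ->]]] /reval_quotient[m [e [ea -> ->]]].
have d0 : d != 0 by apply: contraNneq da => ->; rewrite horner0.
have e0 : e != 0 by apply: contraNneq ea => ->; rewrite horner0.
rewrite addf_div ?tofrac_eq0// (addf_div _ _ da ea) -!hornerM -hornerD.
rewrite -!tofracM -tofracD; apply: revalP => //.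
by rewrite hornerM mulf_neq0.
Qed.

Lemma reval_mul r s a : ~~ is_pole r a -> ~~ is_pole s a ->
  ~~ is_pole (r * s) a /\ reval (r * s) a = reval r a * reval s a.
Proof.
move=> /reval_quotient[n [d [da -> ->]]] /reval_quotient[m [e [ea -> ->]]].
rewrite !mulf_div -!hornerM -!tofracM; apply: revalP => //.
by rewrite hornerM mulf_neq0.
Qed.

Lemma reval_sum (I : Type) (l : seq I) (f : I -> {fraction {poly F}}) a :
  (forall i, ~~ is_pole (f i) a) ->
  ~~ is_pole (\sum_(i <- l) f i) a /\
  reval (\sum_(i <- l) f i) a = \sum_(i <- l) reval (f i) a.
Proof.
move=> fa; elim: l => [|i l [IH1 IH2]].
  by rewrite !big_nil -tofrac0; have := reval_tofrac 0 a; rewrite horner0.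
rewrite !big_cons; have [? ->] := reval_add (fa i) IH1.
by rewrite IH2.
Qed.

End FractionEvaluation.

(** * Words of indices, and the recursion of h_I after evaluation at eta *)

Section Words.
Variable T : eqType.
Implicit Types (J s : seq T) (m n : nat).

(** Words are plain sequences, so that [take] and [drop] cut them at any place within one type and
    sums over long words split into sums over shorter ones. *)
Fixpoint words J n : seq (seq T) :=
  if n is n'.+1 then [seq i :: s | i <- J, s <- words J n'] else [:: [::]].

Lemma mem_words J n s : (s \in words J n) = (size s == n) && all (mem J) s.
Proof.
elim: n s => [|n IH] [|i s] //=.
  by apply/negbTE/negP => /allpairsP[[j t] []].
rewrite eqSS; apply/allpairsP/idP => [[[j t] [/= Jj]]|/and3P[st Ji Js]].
  by rewrite IH => /andP[/eqP <- Jt] [-> ->]; rewrite eqxx Jj.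
by exists (i, s); split => //; rewrite /= IH st.
Qed.

Lemma words_uniq J n : uniq J -> uniq (words J n).
Proof.
by move=> uJ; elim: n => //= n IH; apply: allpairs_uniq => // -[i s] [j t] _ _ [-> ->].
Qed.

Lemma big_words0 (V : nmodType) J (f : seq T -> V) :
  \sum_(s <- words J 0) f s = f [::].
Proof. by rewrite big_seq1. Qed.

Lemma big_wordsS (V : nmodType) J n (f : seq T -> V) :
  \sum_(s <- words J n.+1) f s = \sum_(i <- J) \sum_(s <- words J n) f (i :: s).
Proof. by rewrite /= big_allpairs_dep. Qed.

Lemma big_words1 (V : nmodType) J (f : seq T -> V) :
  \sum_(s <- words J 1) f s = \sum_(i <- J) f [:: i].
Proof. by rewrite big_wordsS; apply: eq_bigr => i _; rewrite big_words0. Qed.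

Lemma big_words_cat (V : nmodType) J m n (f : seq T -> V) :
  \sum_(s <- words J (m + n)) f s =
  \sum_(s <- words J m) \sum_(t <- words J n) f (s ++ t).
Proof.
elim: m f => [|m IH] f; first by rewrite add0n big_words0.
rewrite addSn !big_wordsS; apply: eq_bigr => i _.
exact: (IH (fun s => f (i :: s))).
Qed.

End Words.

Arguments words {T} J n : simpl never.

Section HRecursion.
Variable R : realType.
Implicit Types (s : seq R).

Lemma slice_take_drop s c e : (e <= size s)%N -> slice s c.+1 e = take (e - c) (drop c s).
Proof.
move=> es; have sz : size (take (e - c) (drop c s)) = (e - c)%N.
  by rewrite size_takel// size_drop leq_sub2r.
apply: (@eq_from_nth _ 0); first by rewrite sz size_map size_iota subSS.
move=> i; rewrite size_map size_iota subSS => ie.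
rewrite (nth_map 0%N) ?size_iota ?subSS// nth_iota ?subSS// addSn /=.
by rewrite nth_take// nth_drop.
Qed.

Lemma sum_odd_ord (V : nmodType) (a : nat) (f : nat -> V) :
  (forall m, ~~ odd m -> f m = 0) ->
  \sum_(m < a.*2.+1) f m = \sum_(b < a) f b.*2.+1.
Proof.
move=> f0; elim: a => [|a IH]; first by rewrite big_ord1 big_ord0 f0.
rewrite doubleS big_ord_recr big_ord_recr /= IH big_ord_recr /=.
by rewrite (f0 a.*2.+2) ?addr0//= odd_double.
Qed.

Local Notation "x %:F" := (@tofrac {poly R} x).

(** Kept in multiplied form: the linear factor is nonzero as a rational function but may vanish at
    eta while h_I stays regular there, and both sides can still be evaluated. *)
Lemma hfun_double_rec (a : nat) (ks ls : seq R) : (0 < a)%N -> size ks = a.+1 -> size ls = a ->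
  ((\sum_(k <- ks) k - \sum_(l <- ls) l)%:P - 'X)%:F * hfun a.*2.+1 ks ls =
  \sum_(b < a) hfun b.*2.+1 (take b.+1 ks) (take b ls) *
    hfun (a.-1 - b).*2.+1 (drop b.+1 ks) (take (a.-1 - b) (drop b ls)).
Proof.
case: a => // a _ sk sl; rewrite hfun_odd /= ?odd_double// mulVKf; last first.
  rewrite tofrac_eq0 -size_poly_eq0 -opprB size_polyN size_XsubC.
  by [].
rewrite (@sum_odd_ord _ a.+1 (fun m =>
  hfun m (slice ks 1 m.+1./2) (slice ls 1 m.-1./2) *
  hfun (a.+1.*2 - m) (slice ks m.+3./2 (a.+1.*2).+2./2)
    (slice ls m.+1./2 ((a.+1.*2).+2./2 - 2)))); last first.
  by move=> m om; rewrite hfun_even// mul0r.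
apply: eq_bigr => b _; have ba := ltn_ord b.
have e1 : (b.*2.+2)./2 = b.+1 by rewrite -doubleS doubleK.
have e2 : (b.*2.+4)./2 = b.+2 by rewrite -!doubleS doubleK.
have e3 : ((a.+1.*2).+2)./2 = a.+2 by rewrite -!doubleS doubleK.
rewrite [b.*2.+1.-1]/= e1 e2 e3 doubleK !slice_take_drop; try by lia.
rewrite !drop0 !subn0.
have -> : take (a.+2 - b.+1) (drop b.+1 ks) = drop b.+1 ks.
  by rewrite take_oversize// size_drop sk.
have -> : (a.+1.*2 - b.*2.+1 = (a - b).*2.+1)%N by lia.
by have -> : (a.+2 - 2 - b = a - b)%N by lia.
Qed.

Definition heval (phi : nat -> R) (eta : R) (a : nat) (ks ls : seq nat) : R :=
  reval (hfun a.*2.+1 (map phi ks) (map phi ls)) eta.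

Variables (phi : nat -> R) (eta : R) (n : nat) (J : seq nat).
Hypothesis regJ : forall a (ks ls : seq nat), (a < n)%N -> ks \in words J a.+1 -> ls \in words J a ->
  ~~ is_pole (hfun a.*2.+1 (map phi ks) (map phi ls)) eta.

(** The denominator of h_I at eta, and also the frequency of the corresponding product of
    exponentials relative to exp(- i eta x). *)
Definition resonance (ks ls : seq nat) : R :=
  \sum_(k <- ks) phi k - \sum_(l <- ls) phi l - eta.

Lemma heval0 (k : nat) : (0 < n)%N -> k \in J -> resonance [:: k] [::] * heval phi eta 0 [:: k] [::] = 1.
Proof.
move=> n0 kJ; rewrite /heval /= hfun1 /resonance big_seq1 big_nil subr0.
have := @regJ 0%N [:: k] [::] n0.
rewrite !mem_words /= kJ => /(_ isT isT); rewrite /= hfun1 => np.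
have [np' e'] := reval_tofrac ((phi k)%:P - 'X) eta.
have [_] := reval_mul np' np; rewrite e' mulfV; last first.
  by rewrite tofrac_eq0 -size_poly_eq0 -opprB size_polyN size_XsubC.
rewrite -tofrac1 (proj2 (reval_tofrac 1 eta)) hornerC => ->.
by rewrite hornerD hornerN hornerX hornerC.
Qed.

Lemma heval_rec a (ks ls : seq nat) : (0 < a < n)%N -> ks \in words J a.+1 -> ls \in words J a ->
  resonance ks ls * heval phi eta a ks ls =
  \sum_(b < a) heval phi eta b (take b.+1 ks) (take b ls) *
    heval phi eta (a.-1 - b) (drop b.+1 ks) (take (a.-1 - b) (drop b ls)).
Proof.
move=> /andP[a0 an] kJ lJ.
move: (kJ) (lJ); rewrite !mem_words => /andP[/eqP sk /allP ak] /andP[/eqP sl /allP al].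
have [np' e'] := reval_tofrac ((\sum_(k <- map phi ks) k - \sum_(l <- map phi ls) l)%:P - 'X) eta.
have [_] := reval_mul np' (regJ an kJ lJ).
rewrite hfun_double_rec ?size_map//.
have -> : reval ((\sum_(k <- map phi ks) k - \sum_(l <- map phi ls) l)%:P - 'X)%:F eta =
    resonance ks ls.
  by rewrite e' hornerD hornerN hornerX hornerC !big_map.
rewrite -/(heval phi eta a ks ls) => <-.
(* Each factor must be regular by itself before the value of a product can be split; subwords are
   again words over [J], so [regJ] applies to them. *)
have reg (b : 'I_a) : [/\
    ~~ is_pole (hfun b.*2.+1 (map phi (take b.+1 ks)) (map phi (take b ls))) eta &
    ~~ is_pole (hfun (a.-1 - b).*2.+1 (map phi (drop b.+1 ks))
        (map phi (take (a.-1 - b) (drop b ls)))) eta].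
  have ba := ltn_ord b; split; apply: regJ; rewrite ?mem_words.
  - by lia.
  - apply/andP; split; first by rewrite size_take sk; apply/eqP; case: ltnP; lia.
    by apply/allP => x /mem_take; exact: ak.
  - apply/andP; split; first by rewrite size_take sl; apply/eqP; case: ltnP; lia.
    by apply/allP => x /mem_take; exact: al.
  - by lia.
  - rewrite size_drop sk; apply/andP; split; first by apply/eqP; lia.
    by apply/allP => x /mem_drop; exact: ak.
  - apply/andP; split; first by rewrite size_take size_drop sl; apply/eqP; case: ltnP; lia.
    by apply/allP => x /mem_take /mem_drop; exact: al.
have [|_ ->] := @reval_sum _ _ (index_enum 'I_a) (fun b : 'I_a =>
    hfun b.*2.+1 (take b.+1 (map phi ks)) (take b (map phi ls)) *
    hfun (a.-1 - b).*2.+1 (drop b.+1 (map phi ks))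
      (take (a.-1 - b) (drop b (map phi ls)))) eta.
  move=> b; have [p1 p2] := reg b.
  by rewrite -?map_drop -?map_take; have [] := reval_mul p1 p2.
apply: eq_bigr => b _; have [p1 p2] := reg b; have [_ <-] := reval_mul p1 p2.
by rewrite -?map_drop -?map_take.
Qed.

End HRecursion.

Section WordSums.
Variables (K : comNzRingType) (J : seq nat) (z w : nat -> K).
Implicit Types (f : seq nat -> seq nat -> K).

Definition word_sum (a : nat) f : K :=
  \sum_(ks <- words J a.+1) \sum_(ls <- words J a)
    f ks ls * (\prod_(k <- ks) z k * \prod_(l <- ls) w l).

Lemma eq_word_sum a f g :
  (forall ks ls, ks \in words J a.+1 -> ls \in words J a -> f ks ls = g ks ls) ->
  word_sum a f = word_sum a g.
Proof.
move=> fg; apply: eq_big_seq => ks kJ; apply: eq_big_seq => ls lJ.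
by rewrite fg.
Qed.

(** The last letter of [ls] is read by neither [f] nor [g], as l_(P-1) occurs in neither factor of
    the recursion of h_I; its sum therefore splits off. *)
Lemma word_sum_cat m n f g :
  \sum_(ks <- words J (m.+1 + n.+1)) \sum_(ls <- words J (m + (n + 1)))
    (f (take m.+1 ks) (take m ls) * g (drop m.+1 ks) (take n (drop m ls))) *
    (\prod_(k <- ks) z k * \prod_(l <- ls) w l) =
  word_sum m f * word_sum n g * \sum_(l <- J) w l.
Proof.
rewrite big_words_cat /word_sum big_distrlr /= mulr_suml; apply: eq_big_seq => k1.
rewrite mem_words => /andP[/eqP s1 _]; rewrite mulr_suml; apply: eq_bigr => k2 _.
rewrite big_words_cat big_distrlr /= mulr_suml; apply: eq_big_seq => l1.
rewrite mem_words => /andP[/eqP t1 _]; rewrite mulr_suml big_words_cat.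
apply: eq_big_seq => l2; rewrite mem_words => /andP[/eqP t2 _].
rewrite big_words1 mulr_sumr; apply: eq_bigr => l _.
rewrite !take_size_cat// !drop_size_cat// !take_size_cat// !big_cat big_seq1 /=.
by ring.
Qed.

(** The recursion of h_I becomes a convolution of lower orders. The prefactor, the sum over the free
    letter, is the conj(phi) in front of r^2 in the Riccati equation. *)
Lemma word_sum_convolution a (h : nat -> seq nat -> seq nat -> K) : (0 < a)%N ->
  word_sum a (fun ks ls => \sum_(b < a) h b (take b.+1 ks) (take b ls) *
     h (a.-1 - b)%N (drop b.+1 ks) (take (a.-1 - b) (drop b ls))) =
  (\sum_(l <- J) w l) * \sum_(b < a) word_sum b (h b) * word_sum (a.-1 - b) (h (a.-1 - b)%N).
Proof.
case: a => // a _; rewrite mulr_sumr /=.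
transitivity (\sum_(b < a.+1) word_sum a.+1 (fun ks ls =>
    h b (take b.+1 ks) (take b ls) * h (a - b)%N (drop b.+1 ks) (take (a - b) (drop b ls)))).
  rewrite /word_sum [RHS]exchange_big /=; apply: eq_bigr => ks _.
  rewrite [RHS]exchange_big /=; apply: eq_bigr => ls _.
  by rewrite mulr_suml.
apply: eq_bigr => b _; rewrite mulrC -word_sum_cat /word_sum.
have ba := ltn_ord b.
have -> : (b.+1 + (a - b).+1 = a.+2)%N by lia.
by have -> : (b + (a - b + 1) = a.+1)%N by lia.
Qed.

End WordSums.

Section Triangle.
Variables (V : zmodType) (G : nat -> nat -> V).

(** Differentiating the orders [a < n] yields the pairs with b + b' = a - 1, whereas the square of
    the sum contains every pair below [n]. This isolates the part of the square that is matched. *)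
Lemma big_antidiagonals (N n : nat) : (n <= N)%N ->
  \sum_(a < n) \sum_(b < a) G b (a.-1 - b) =
  \sum_(b < N) \sum_(b' < N | (b + b' + 1 < n)%N) G b b'.
Proof.
elim: n => [|n IH] nN.
  by rewrite big_ord0 big1// => b _; rewrite big_pred0.
rewrite big_ord_recr /= IH 1?ltnW//.
have -> : \sum_(b < N) \sum_(b' < N | (b + b' + 1 < n.+1)%N) G b b' =
    \sum_(b < N) \sum_(b' < N | (b + b' + 1 < n)%N) G b b' +
    \sum_(b < N) \sum_(b' < N | (b + b' + 1)%N == n) G b b'.
  rewrite -big_split; apply: eq_bigr => b _ /=.
  rewrite (bigID (fun b' : 'I_N => (b + b' + 1 < n)%N)) /=.
  by congr (_ + _); apply: eq_bigl => b'; lia.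
congr (_ + _); rewrite (bigID (fun b : 'I_N => (b < n)%N)) /=.
rewrite [X in _ = _ + X]big1 ?addr0; last first.
  by move=> b bn; rewrite big_pred0// => b'; lia.
rewrite (big_ord_widen N (fun b => G b (n.-1 - b)))//; last exact: ltnW.
apply: eq_bigr => b bn; have h : (n.-1 - b < N)%N by lia.
rewrite (big_pred1 (Ordinal h))//= => b'.
by apply/eqP/eqP => [?|-> /=]; [apply: val_inj => /=|]; lia.
Qed.

End Triangle.

(** * Approximate solutions of the Riccati equation *)

Section ComplexCalculus.
Variable R : realType.
Implicit Types (x k a b : R) (f g : R -> R[i]) (u v : R[i]).

Lemma ReD u v : complex.Re (u + v) = complex.Re u + complex.Re v.
Proof. by case: u v => [? ?] [? ?]. Qed.
Lemma ImD u v : complex.Im (u + v) = complex.Im u + complex.Im v.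
Proof. by case: u v => [? ?] [? ?]. Qed.
Lemma ReN u : complex.Re (- u) = - complex.Re u. Proof. by case: u. Qed.
Lemma ImN u : complex.Im (- u) = - complex.Im u. Proof. by case: u. Qed.
Lemma ReM u v :
  complex.Re (u * v) = complex.Re u * complex.Re v - complex.Im u * complex.Im v.
Proof. by case: u v => [? ?] [? ?]. Qed.
Lemma ImM u v :
  complex.Im (u * v) = complex.Re u * complex.Im v + complex.Im u * complex.Re v.
Proof. by case: u v => [? ?] [? ?]. Qed.
Lemma ReJ u : complex.Re (conjc u) = complex.Re u. Proof. by case: u. Qed.
Lemma ImJ u : complex.Im (conjc u) = - complex.Im u. Proof. by case: u. Qed.

Lemma normc_ge0 u : 0 <= normc u. Proof. by case: u => x y; exact: sqrtr_ge0. Qed.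

Lemma normc_sqr u : normc u ^+ 2 = complex.Re u ^+ 2 + complex.Im u ^+ 2.
Proof. by case: u => x y; rewrite sqr_sqrtr// addr_ge0 ?sqr_ge0. Qed.

Lemma normcJ u : normc (conjc u) = normc u.
Proof. by case: u => x y /=; rewrite sqrrN. Qed.

Lemma normc_real k : normc k%:C = `|k|.
Proof. by rewrite /= expr0n addr0 sqrtr_sqr. Qed.

Lemma normc_i : normc 'i%C = 1 :> R.
Proof. by rewrite /= expr0n add0r expr1n sqrtr1. Qed.

Lemma normc_expi k : normc (expi k) = 1.
Proof. by rewrite /= cos2Dsin2 sqrtr1. Qed.

Lemma normc_sum (I : Type) (s : seq I) (P : pred I) (F : I -> R[i]) :
  normc (\sum_(i <- s | P i) F i) <= \sum_(i <- s | P i) normc (F i).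
Proof.
elim/big_ind2: _ => [|x1 x2 y1 y2 h1 h2|//]; first by rewrite normc0.
exact: le_trans (le_normcD _ _) (lerD h1 h2).
Qed.

Lemma normc_prod (I : Type) (s : seq I) (P : pred I) (F : I -> R[i]) :
  normc (\prod_(i <- s | P i) F i) = \prod_(i <- s | P i) normc (F i).
Proof. by elim/big_rec2: _ => [|i x y _ <-]; rewrite ?normc1 ?normcM. Qed.

Lemma conjc_sum (I : Type) (s : seq I) (P : pred I) (F : I -> R[i]) :
  conjc (\sum_(i <- s | P i) F i) = \sum_(i <- s | P i) conjc (F i).
Proof. by rewrite rmorph_sum. Qed.

Lemma Re_le_normc u : `|complex.Re u| <= normc u.
Proof.
by apply: sqr_le_norm; rewrite ?normc_ge0// normc_sqr lerDl sqr_ge0.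
Qed.

Lemma Im_le_normc u : `|complex.Im u| <= normc u.
Proof.
by apply: sqr_le_norm; rewrite ?normc_ge0// normc_sqr lerDr sqr_ge0.
Qed.

Definition is_cderive x f u :=
  is_derive x 1 (fun t => complex.Re (f t)) (complex.Re u) /\
  is_derive x 1 (fun t => complex.Im (f t)) (complex.Im u).

Lemma is_cderive_cst x u : is_cderive x (fun=> u) 0.
Proof. by split; exact: is_derive_cstf. Qed.

Lemma is_cderiveD x f g u v : is_cderive x f u -> is_cderive x g v ->
  is_cderive x (fun t => f t + g t) (u + v).
Proof.
move=> [f1 f2] [g1 g2]; split.
  rewrite ReD; under eq_fun do rewrite ReD; exact: is_derive_addf.
rewrite ImD; under eq_fun do rewrite ImD; exact: is_derive_addf.
Qed.

Lemma is_cderiveN x f u : is_cderive x f u -> is_cderive x (fun t => - f t) (- u).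
Proof.
move=> [f1 f2]; split.
  rewrite ReN; under eq_fun do rewrite ReN; exact: is_derive_oppf.
rewrite ImN; under eq_fun do rewrite ImN; exact: is_derive_oppf.
Qed.

Lemma is_cderiveJ x f u : is_cderive x f u -> is_cderive x (fun t => conjc (f t)) (conjc u).
Proof.
move=> [f1 f2]; split.
  by rewrite ReJ; under eq_fun do rewrite ReJ.
rewrite ImJ; under eq_fun do rewrite ImJ; exact: is_derive_oppf.
Qed.

Lemma is_cderiveM x f g u v : is_cderive x f u -> is_cderive x g v ->
  is_cderive x (fun t => f t * g t) (u * g x + f x * v).
Proof.
move=> [f1 f2] [g1 g2]; split.
  under eq_fun do rewrite ReM.
  apply: is_derive_eq (is_derive_addf (is_derive_mulf f1 g1)
    (is_derive_oppf (is_derive_mulf f2 g2))) _.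
  by rewrite ReD !ReM; ring.
under eq_fun do rewrite ImM.
apply: is_derive_eq (is_derive_addf (is_derive_mulf f1 g2) (is_derive_mulf f2 g1)) _.
by rewrite ImD !ImM; ring.
Qed.

Lemma is_cderive_sum x (I : Type) (s : seq I) (F : I -> R -> R[i]) (D : I -> R[i]) :
  (forall i, is_cderive x (F i) (D i)) ->
  is_cderive x (fun t => \sum_(i <- s) F i t) (\sum_(i <- s) D i).
Proof.
move=> FD; elim: s => [|i s IH].
  by rewrite big_nil; under eq_fun do rewrite big_nil; exact: is_cderive_cst.
by rewrite big_cons; under eq_fun do rewrite big_cons; exact: is_cderiveD.
Qed.

(* Functions with [f' = u f] are stable under products, the logarithmic
   derivatives adding up. *)
Lemma is_cderive_prod x (I : Type) (s : seq I) (F : I -> R -> R[i]) (D : I -> R[i]) :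
  (forall i, is_cderive x (F i) (D i * F i x)) ->
  is_cderive x (fun t => \prod_(i <- s) F i t) ((\sum_(i <- s) D i) * \prod_(i <- s) F i x).
Proof.
move=> FD; elim: s => [|i s IH].
  rewrite !big_nil mul0r; under eq_fun do rewrite big_nil; exact: is_cderive_cst.
rewrite !big_cons; under eq_fun do rewrite big_cons.
have -> : (D i + \sum_(j <- s) D j) * (F i x * \prod_(j <- s) F j x) =
  D i * F i x * \prod_(j <- s) F j x + F i x * ((\sum_(j <- s) D j) * \prod_(j <- s) F j x).
  by ring.
exact: is_cderiveM.
Qed.

Lemma is_cderive_expi k x : is_cderive x (fun t => expi (k * t)) ('i%C * k%:C * expi (k * x)).
Proof.
split; rewrite /expi /=.
  by apply: is_derive_eq (is_derive_cosM k x) _; ring.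
by apply: is_derive_eq (is_derive_sinM k x) _; ring.
Qed.

Definition cacont a b f :=
  acont a b (fun t => complex.Re (f t)) /\ acont a b (fun t => complex.Im (f t)).

Lemma cacont_cst a b u : cacont a b (fun=> u).
Proof. by split; exact: acont_cst. Qed.

Lemma cacontD a b f g : cacont a b f -> cacont a b g -> cacont a b (fun t => f t + g t).
Proof.
move=> [f1 f2] [g1 g2]; split.
  by under eq_fun do rewrite ReD; exact: (acontD f1 g1).
by under eq_fun do rewrite ImD; exact: (acontD f2 g2).
Qed.

Lemma cacontN a b f : cacont a b f -> cacont a b (fun t => - f t).
Proof.
move=> [f1 f2]; split.
  by under eq_fun do rewrite ReN; exact: (acontN f1).
by under eq_fun do rewrite ImN; exact: (acontN f2).
Qed.

Lemma cacontJ a b f : cacont a b f -> cacont a b (fun t => conjc (f t)).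
Proof.
move=> [f1 f2]; split; first by under eq_fun do rewrite ReJ.
by under eq_fun do rewrite ImJ; exact: (acontN f2).
Qed.

Lemma cacontM a b f g : cacont a b f -> cacont a b g -> cacont a b (fun t => f t * g t).
Proof.
move=> [f1 f2] [g1 g2]; split.
  by under eq_fun do rewrite ReM; apply: (acontD (acontM f1 g1) (acontN (acontM f2 g2))).
by under eq_fun do rewrite ImM; apply: (acontD (acontM f1 g2) (acontM f2 g1)).
Qed.

Lemma cacont_sum a b (I : Type) (s : seq I) (F : I -> R -> R[i]) :
  (forall i, cacont a b (F i)) -> cacont a b (fun t => \sum_(i <- s) F i t).
Proof.
move=> Fi; elim: s => [|i s IH].
  by under eq_fun do rewrite big_nil; exact: cacont_cst.
by under eq_fun do rewrite big_cons; exact: (cacontD (Fi i) IH).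
Qed.

Lemma cacont_prod a b (I : Type) (s : seq I) (F : I -> R -> R[i]) :
  (forall i, cacont a b (F i)) -> cacont a b (fun t => \prod_(i <- s) F i t).
Proof.
move=> Fi; elim: s => [|i s IH].
  by under eq_fun do rewrite big_nil; exact: cacont_cst.
by under eq_fun do rewrite big_cons; exact: (cacontM (Fi i) IH).
Qed.

Lemma cacont_expi a b k : cacont a b (fun t => expi (k * t)).
Proof. by split; [exact: acont_cosM|exact: acont_sinM]. Qed.

End ComplexCalculus.

Section RiccatiSum.
Variables (R : realType) (phi : nat -> R) (eta : R) (n : nat) (J : seq nat).
Variable beta : nat -> R[i].
Implicit Types (x t : R) (ks ls : seq nat).

Definition wave (k : nat) t : R[i] := beta k * expi (- phi k * t).

Definition riccati_term (a : nat) t : R[i] :=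
  word_sum J (fun k => wave k t) (fun l => conjc (wave l t)) a
    (fun ks ls => (heval phi eta a ks ls)%:C).

Definition riccati t : R[i] := - \sum_(a < n) riccati_term a t.

(** The products in the square of [riccati] that no retained order produces. Each has degree (2b +
    1) + (2b' + 1) >= 2n in the waves, and the conj(phi) in front raises this to at least p. *)
Definition riccati_rem t : R[i] :=
  \sum_(b < n) \sum_(b' < n | ~~ (b + b' + 1 < n)%N) riccati_term b t * riccati_term b' t.

Lemma is_cderive_eq x (f : R -> R[i]) u v : is_cderive x f u -> u = v -> is_cderive x f v.
Proof. by move=> ? <-. Qed.

Lemma is_cderive_wave k x : is_cderive x (wave k) (- 'i%C * (phi k)%:C * wave k x).
Proof.
apply: is_cderive_eq (is_cderiveM (is_cderive_cst x (beta k)) (is_cderive_expi (- phi k) x)) _.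
by rewrite /wave rmorphN; ring.
Qed.

Lemma is_cderive_waveJ k x :
  is_cderive x (fun t => conjc (wave k t)) ('i%C * (phi k)%:C * conjc (wave k x)).
Proof.
apply: is_cderive_eq (is_cderiveJ (is_cderive_wave k x)) _.
by rewrite !rmorphM /= oppr0 opprK.
Qed.

(** A product of waves is differentiated by multiplying it by - i times its total frequency, written
    as eta plus the resonance: the first part is the linear term of the Riccati equation, the second
    cancels the denominator of h_I. *)
Lemma is_cderive_riccati_term a x :
  is_cderive x (riccati_term a) (- 'i%C * eta%:C * riccati_term a x
    - 'i%C * word_sum J (fun k => wave k x) (fun l => conjc (wave l x)) a
        (fun ks ls => (resonance phi eta ks ls * heval phi eta a ks ls)%:C)).
Proof.
apply: is_cderive_eq.
  apply: is_cderive_sum => ks; apply: is_cderive_sum => ls.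
  apply: is_cderiveM; first exact: is_cderive_cst.
  apply: is_cderiveM.
    exact: (is_cderive_prod ks (fun k => is_cderive_wave k x)).
  exact: (is_cderive_prod ls (fun k => is_cderive_waveJ k x)).
rewrite /riccati_term /word_sum !mulr_sumr -sumrB; apply: eq_bigr => ks _.
rewrite !mulr_sumr -sumrB; apply: eq_bigr => ls _.
move: (heval phi eta a ks ls) => h; rewrite rmorphM /resonance !rmorphB /= !rmorph_sum /= -!mulr_sumr.
by ring.
Qed.

Hypothesis regJ : forall a ks ls, (a < n)%N -> ks \in words J a.+1 -> ls \in words J a ->
  ~~ is_pole (hfun a.*2.+1 (map phi ks) (map phi ls)) eta.

Lemma is_cderive_riccati x : (0 < n)%N ->
  let F := \sum_(k <- J) wave k x in
  is_cderive x riccati (- 'i%C * eta%:C * riccati x + 'i%C * F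
    + 'i%C * conjc F * (riccati x ^+ 2 - riccati_rem x)).
Proof.
move=> n0 F; apply: is_cderive_eq.
  by apply/is_cderiveN/is_cderive_sum => a; exact: is_cderive_riccati_term.
pose g a := riccati_term a x.
have conv (a : 'I_n) : word_sum J (fun k => wave k x) (fun l => conjc (wave l x)) a
        (fun ks ls => (resonance phi eta ks ls * heval phi eta a ks ls)%:C) =
    (if a == 0%N :> nat then F else 0) + conjc F * \sum_(b < a) g b * g (a.-1 - b)%N.
  case: a => -[|a] an /=.
    rewrite big_ord0 mulr0 addr0 /word_sum big_words1 /F; apply: eq_big_seq => k kJ.
    rewrite big_words0 big_seq1 big_nil mulr1.
    by rewrite (heval0 regJ n0 kJ) rmorph1 mul1r.
  rewrite add0r /F conjc_sum; apply: etrans (@word_sum_convolution _ J (fun k => wave k x)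
    (fun l => conjc (wave l x)) a.+1 (fun b ks ls => (heval phi eta b ks ls)%:C) isT).
  apply: eq_word_sum => ks ls kJ lJ; rewrite (heval_rec regJ)// rmorph_sum /=.
  apply: eq_bigr => b _.
  by move: (heval _ _ _ _ _) (heval _ _ _ _ _) => u v; rewrite rmorphM.
have -> : \sum_(a < n) (- 'i%C * eta%:C * riccati_term a x
    - 'i%C * word_sum J (fun k => wave k x) (fun l => conjc (wave l x)) a
        (fun ks ls => (resonance phi eta ks ls * heval phi eta a ks ls)%:C)) =
    - 'i%C * eta%:C * (\sum_(a < n) g a) - 'i%C * (F + conjc F *
      \sum_(a < n) \sum_(b < a) g b * g (a.-1 - b)%N).
  rewrite sumrB -!mulr_sumr (eq_bigr _ (fun a _ => conv a)) big_split /= -mulr_sumr.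
  congr (_ - _ * (_ + _)).
  by case: n n0 => // m _; rewrite big_ord_recl /= big1 ?addr0.
rewrite (big_antidiagonals (fun b b' => g b * g b') (leqnn n)).
have -> : riccati x ^+ 2 = \sum_(b < n) \sum_(b' < n | (b + b' + 1 < n)%N) g b * g b' + riccati_rem x.
  rewrite /riccati sqrrN expr2 big_distrlr -big_split /=; apply: eq_bigr => b _.
  by rewrite (bigID (fun b' : 'I_n => (b + b' + 1 < n)%N)).
rewrite /riccati /g; ring.
Qed.

Lemma cacont_riccati (u v : R) : cacont u v riccati.
Proof.
have cw k : cacont u v (wave k) by apply: cacontM; [exact: cacont_cst|exact: cacont_expi].
apply/cacontN/cacont_sum => a; apply: cacont_sum => ks; apply: cacont_sum => ls.
apply: cacontM; first exact: cacont_cst.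
apply: cacontM; first by apply: cacont_prod => k; exact: cw.
by apply: cacont_prod => k; exact: cacontJ.
Qed.

Lemma normc_wave k t : normc (wave k t) = normc (beta k).
Proof. by rewrite /wave normcM normc_expi mulr1. Qed.

End RiccatiSum.

(** * Bounded variation and sampling at the integers *)

Import HBNNSimple.

Section BoundedVariation.
Variable R : realType.
Implicit Types (g : R -> R[i]) (x t tau sigma : R).
Local Notation mu := (@lebesgue_measure R).

Lemma variation_function g tau : (Var g <= tau%:E)%E -> exists W : R -> R,
  (forall x, 0 < x -> 0 <= W x <= tau) /\
  (forall x t, 0 < x -> x <= t -> normc (g t - g x) <= W t - W x).
Proof.
move=> gtau.
pose psum k (y : nat -> R) := \sum_(1 <= j < k.+1) normc (g (y j) - g (y j.-1)).
pose ispart k (y : nat -> R) := 0 < y 0%N /\ forall j, (j < k)%N -> y j < y j.+1.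
pose S x := [set v : R | exists k y, [/\ ispart k y, y k = x & v = psum k y]].
have S0 x : 0 < x -> S x 0.
  move=> x0; exists 0%N, (fun=> x); split; [by split|by []|].
  by apply/esym; rewrite /psum big_geq.
have Stau x v : S x v -> v <= tau.
  move=> [k [y [[y0 yk] _ ->]]]; rewrite -lee_fin; apply: le_trans gtau.
  by apply: ereal_sup_ubound; exists k, y; split.
have supS x : 0 < x -> has_sup (S x).
  by move=> x0; split; [exists 0; exact: S0|exists tau => v; exact: Stau].
exists (fun x => sup (S x)); split=> [x x0|x t x0].
  apply/andP; split; first by apply: sup_upper_bound; [exact: supS|exact: S0].
  by apply: ge_sup; [exists 0; exact: S0|exact: Stau].
rewrite le_eqVlt => /predU1P[<-|xt]; first by rewrite !subrr normc0.
rewrite lerBrDr addrC -lerBrDr; apply: ge_sup; first by exists 0; exact: S0.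
move=> v [k [y [[y0 yk] ykx ->]]]; rewrite lerBrDr.
apply: sup_upper_bound; first by apply: supS; exact: lt_trans xt.
pose y' j := if (j <= k)%N then y j else t.
exists k.+1, y'; split.
- split=> [|j]; first by rewrite /y'.
  rewrite ltnS leq_eqVlt => /predU1P[->|jk]; rewrite /y' ?leqnn ?ltnn ?ykx//.
  by rewrite (ltnW jk) jk yk.
- by rewrite /y' ltnn.
- rewrite /psum (big_nat_recr k.+1)//= /y' leqnn ltnn ykx; congr (_ + _).
  apply: eq_big_nat => j /andP[j1 jk]; rewrite -ltnS jk.
  by rewrite (leq_trans (leq_pred j)).
Qed.

(* No measurability of [f] is assumed: the integral of a nonnegative function is
   the supremum of the integrals of the simple functions below it. *)
Lemma sum_cst_le_integral (f : R -> R) (u : nat -> R) (M : nat) (K : R) :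
    (forall x, 0 <= f x) -> (forall m, 0 <= u m) ->
    (forall m t, m.+1%:R <= t < m.+2%:R -> u m <= f t) ->
    (\int[mu]_(t in `]0%R, +oo[) (f t)%:E <= K%:E)%E ->
  \sum_(m < M) u m <= K.
Proof.
move=> f0 u0 uf; rewrite -lee_fin; apply: le_trans.
pose I (m : nat) := `[m.+1%:R, m.+2%:R[%classic : set (measurableTypeR R).
have mI m : measurable (I m) by exact: measurable_itv.
pose h := sum_nnsfun (fun m => scale_nnsfun (indic_nnsfun R (mI m)) (u0 m)) M.
have hE t : h t = \sum_(m < M) u m * \1_(I m) t by rewrite sum_nnsfunE.
have -> : ((\sum_(m < M) u m)%:E = \int[mu]_x (h x)%:E)%E.
  transitivity (\int[mu]_x (\sum_(m < M) (u m)%:E * (\1_(I m) x)%:E))%E; last first.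
    by apply: eq_integral => x _; rewrite hE -sumEFin.
  rewrite ge0_integral_sum//; last 2 first.
  - move=> m; apply/measurable_realfun.measurable_EFinP/measurable_realfun.measurable_funM.
    + exact: measurable_cst.
    + apply: measurable_realfun.measurable_indic; exact: mI.
  - by move=> m x _; rewrite -EFinM lee_fin mulr_ge0.
  rewrite -sumEFin; apply: eq_bigr => m _.
  rewrite ge0_integralZl_EFin//; last first.
    by apply/measurable_realfun.measurable_EFinP/measurable_realfun.measurable_indic; exact: mI.
  have Im : (\int[mu]_x (\1_(I m) x)%:E = 1)%E.
    have := @integral_indic _ _ R mu setT measurableT (I m) (mI m).
    rewrite setIT => ->; transitivity (mu (I m)) => //.
    by rewrite lebesgue_measure_itv /= lte_fin ltr_nat ltnSn -EFinB -natrB// subSnn.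
  by rewrite Im mule1.
rewrite [leLHS](_ : _ = sintegral mu h); last exact: (@integralT_nnsfun _ _ R mu h).
rewrite integral_mkcond ge0_integralTE; last first.
  by move=> x; rewrite /patch; case: ifP => //; rewrite lee_fin.
apply: ereal_sup_ubound; exists h => //= x; rewrite /patch.
have [x0|x0] := boolP (x \in _).
  rewrite lee_fin hE.
  have [[m [mM xm]]|nm] := pselect (exists m, (m < M)%N /\ I m x).
    rewrite (bigD1 (Ordinal mM))//= big1 ?addr0.
      by rewrite indicE mem_set// mulr1; apply: uf; move: xm; rewrite /I /= in_itv.
    move=> i; rewrite -val_eqE /= => im; rewrite indicE memNset ?mulr0//.
    move: xm; rewrite /I /= !in_itv /= => /andP[h1 h2] /andP[h3 h4].
    move: im; rewrite neq_ltn => /orP[im|im].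
      have : (i.+2%:R : R) <= m.+1%:R by rewrite ler_nat.
      by move/(lt_le_trans h4)/(le_lt_trans h1); rewrite ltxx.
    have : (m.+2%:R : R) <= i.+1%:R by rewrite ler_nat.
    by move/(lt_le_trans h2)/(le_lt_trans h3); rewrite ltxx.
  rewrite big1// => i _; rewrite indicE memNset ?mulr0// => Ix.
  by apply: nm; exists i.
rewrite lee_fin hE big1// => i _; rewrite indicE memNset ?mulr0// => Ix.
move: x0; rewrite notin_setE; apply; move: Ix; rewrite /I /= !in_itv /= andbT => /andP[h1 _].
exact: lt_le_trans h1.
Qed.

Lemma normc_le_addl (u v : R[i]) : normc u <= normc v + normc (v - u).
Proof.
have {1}-> : u = v - (v - u) by rewrite opprB addrC subrK.
by apply: le_trans (le_normcD _ _) _; rewrite normcN.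
Qed.

Lemma ex_small_term (y : nat -> R) (L d : R) : 0 < d ->
  (forall M, \sum_(m < M) y m <= L) -> exists m, y m <= d.
Proof.
move=> d0 yL; apply: contrapT => H.
have yd m : d <= y m by apply: ltW; rewrite ltNge; apply/negP => h; apply: H; exists m.
have L0 : 0 <= L by have := yL 0%N; rewrite big_ord0.
pose M := (Num.truncn (L / d)).+1.
have : M%:R * d <= L.
  apply: le_trans (yL M); rewrite mulr_natl -[X in _ *+ X](card_ord M) -sumr_const.
  by apply: ler_sum.
rewrite -ler_pdivlMr// leNgt; apply/negP; rewrite negbK.
exact: truncnS_gt.
Qed.

(** The grid starts at 1, so index [m] stands for [m+1, m+2]. The majorant adds the variation on
    this interval to the p-th power of a lower bound for |g| on it: the first part telescopes, the
    second is summed by the integral. *)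
Lemma gamma_steps g tau sigma (p : nat) : (0 < p)%N -> 0 <= tau ->
    (Var g <= tau%:E)%E ->
    (\int[mu]_(t in `]0%R, +oo[) (normc (g t) ^+ p)%:E <= sigma%:E)%E ->
  exists y : nat -> R, [/\ forall m, 0 <= y m,
    forall M, \sum_(m < M) y m <= sigma + tau,
    forall m t, m.+1%:R <= t <= m.+2%:R -> normc (g t - g m.+1%:R) <= y m,
    forall m, normc (g m.+1%:R) ^+ p <= (2 * (tau + 1)) ^+ p * y m &
    forall x, 0 < x -> normc (g x) <= tau + 1].
Proof.
move=> p0 tau0 /variation_function[W [W1 W2]] gsigma.
have n0 m : 0 < m.+1%:R :> R by [].
pose v m := W m.+2%:R - W m.+1%:R.
(* The sampled value lowered by the variation bounds |g| from below on the whole interval, so its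
   p-th power can be compared with the integral. *)
pose w m := Num.max 0 (normc (g m.+1%:R) - v m).
have v0 m : 0 <= v m.
  by apply: le_trans (normc_ge0 _) (W2 m.+1%:R m.+2%:R _ _); rewrite ?ler_nat.
have w0 m : 0 <= w m by rewrite le_max lexx.
have gv m t : m.+1%:R <= t <= m.+2%:R -> normc (g t - g m.+1%:R) <= v m.
  move=> /andP[mt tm]; apply: le_trans (W2 _ _ (n0 m) mt) _; rewrite lerB//.
  by rewrite -subr_ge0; apply: le_trans (normc_ge0 _) (W2 _ _ (lt_le_trans (n0 m) mt) tm).
have vtau m : v m <= tau.
  have /andP[h1 h2] := W1 _ (n0 m); have /andP[h3 h4] := W1 _ (n0 m.+1).
  by rewrite /v; lra.
have sumv M : \sum_(m < M) v m <= tau.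
  have -> : \sum_(m < M) v m = W M.+1%:R - W 1.
    elim: M => [|M IH]; first by rewrite big_ord0 subrr.
    by rewrite big_ord_recr /= IH /v; ring.
  have /andP[h1 h2] := W1 _ (n0 M); have /andP[h3 h4] := W1 1 ltr01.
  lra.
have sumw M : \sum_(m < M) w m ^+ p <= sigma.
  apply: (@sum_cst_le_integral (fun t => normc (g t) ^+ p) (fun m => w m ^+ p) M) => //.
  - by move=> x; rewrite exprn_ge0 ?normc_ge0.
  - by move=> m; exact: exprn_ge0.
  move=> m t /andP[mt tm]; rewrite lerXn2r ?nnegrE ?normc_ge0//.
  rewrite ge_max normc_ge0 /= lerBlDr; apply: le_trans (normc_le_addl _ (g t)) _.
  by rewrite lerD2l gv// mt ltW.
have gwv' m : normc (g m.+1%:R) <= w m + v m by rewrite -lerBlDr le_max lexx orbT.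
clearbody w; clearbody v.
pose T := tau + 1; have T1 : 1 <= T by rewrite /T; lra.
have T0 : 0 < T by lra.
(* The sampled value is at most [w m + v m], whose p-th power is at most 2^p times the sum of the
   p-th powers; as [v m / T <= 1], the power of [v m] drops to the first at the cost of T^p. *)
have gp m : normc (g m.+1%:R) ^+ p <= (2 * T) ^+ p * (w m ^+ p + v m).
  have wm := w0 m; have vm := v0 m.
  have gwv := gwv' m.
  apply: (@le_trans _ _ ((w m + v m) ^+ p)).
    by rewrite lerXn2r ?nnegrE ?normc_ge0 ?addr_ge0.
  have vp : v m ^+ p <= T ^+ p * v m.
    have -> : v m ^+ p = T ^+ p * (v m / T) ^+ p.
      by rewrite expr_div_n mulrCA divff ?mulr1// expf_neq0// gt_eqF.
    rewrite ler_wpM2l ?exprn_ge0 ?(ltW T0)//.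
    have vT0 : 0 <= v m / T by rewrite divr_ge0// ltW.
    have vT1 : v m / T <= 1.
      by rewrite ler_pdivrMr// mul1r (le_trans (vtau m))// /T; lra.
    apply: (@le_trans _ _ (v m / T)).
      by rewrite -[leRHS]expr1; apply: ler_wiXn2l.
    by rewrite ler_pdivrMr// ler_peMr.
  rewrite exprMn -mulrA.
  have Tp : 1 <= T ^+ p by rewrite exprn_ege1.
  have wp0 : 0 <= w m ^+ p by exact: exprn_ge0.
  apply: (@le_trans _ _ (2 ^+ p * (w m ^+ p + v m ^+ p))); last first.
    rewrite ler_wpM2l ?exprn_ge0// mulrDr lerD//.
    by rewrite ler_peMl.
  have [h|h] := leP (w m) (v m).
    apply: (@le_trans _ _ (2 ^+ p * v m ^+ p)).
      rewrite -exprMn lerXn2r ?nnegrE ?addr_ge0 ?mulr_ge0//; lra.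
    by rewrite ler_wpM2l ?exprn_ge0// lerDr.
  apply: (@le_trans _ _ (2 ^+ p * w m ^+ p)).
    rewrite -exprMn lerXn2r ?nnegrE ?addr_ge0 ?mulr_ge0//; lra.
  by rewrite ler_wpM2l ?exprn_ge0// lerDl exprn_ge0.
pose y m := w m ^+ p + v m.
have sumy M : \sum_(m < M) y m <= sigma + tau by rewrite big_split lerD.
exists y; split=> //.
- by move=> m; rewrite addr_ge0 ?exprn_ge0.
- by move=> m t mt; rewrite (le_trans (gv _ _ mt))// lerDr exprn_ge0.
(* Bounded partial sums force some [y m] to be so small that the sampled value there is at most 1;
   the variation carries this bound to every [x]. *)
move=> x x0; have d0 : 0 < ((2 * T) ^+ p)^-1 by rewrite invr_gt0 exprn_gt0// mulr_gt0.
have [m ym] := ex_small_term d0 sumy.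
have gm1 : normc (g m.+1%:R) <= 1.
  rewrite -(@ler_pXn2r _ p)// ?nnegrE ?normc_ge0// expr1n (le_trans (gp m))//.
  rewrite -[leRHS](@divff _ ((2 * T) ^+ p)) ?gt_eqF ?exprn_gt0 ?mulr_gt0//.
  by rewrite ler_wpM2l// exprn_ge0// mulr_ge0// ltW.
have gxm : normc (g m.+1%:R - g x) <= tau.
  have [mx|xm] := leP m.+1%:R x.
    rewrite -normcN opprB; apply: le_trans (W2 _ _ (n0 m) mx) _.
    by have /andP[? ?] := W1 _ x0; have /andP[? ?] := W1 _ (n0 m); lra.
  apply: le_trans (W2 _ _ x0 (ltW xm)) _.
  by have /andP[? ?] := W1 _ x0; have /andP[? ?] := W1 _ (n0 m); lra.
by apply: le_trans (normc_le_addl _ (g m.+1%:R)) _; lra.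
Qed.

End BoundedVariation.

(** * Summability estimates *)

Section ProductBounds.
Variables (R : realType) (I : Type).
Implicit Types (s : seq I) (g : I -> R) (p : nat).

Lemma prod_le1 s g : (forall i, 0 <= g i <= 1) -> 0 <= \prod_(i <- s) g i <= 1.
Proof.
move=> g01; elim: s => [|i s /andP[h0 h1]]; first by rewrite big_nil ler01 lexx.
have /andP[g0 g1] := g01 i.
by rewrite big_cons mulr_ge0//= mulr_ile1.
Qed.

(** The product is at most the power [size s] of the largest factor, hence at most its p-th power,
    which is one of the summands. *)
Lemma prod_le_sum_pow s g p : (0 < p <= size s)%N -> (forall i, 0 <= g i <= 1) ->
  \prod_(i <- s) g i <= \sum_(i <- s) g i ^+ p.
Proof.
move=> /andP[p0 ps] g01.
have g0 i : 0 <= g i by have /andP[] := g01 i.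
have [M [M0 M1 Ms Mp]] : exists M : R, [/\ 0 <= M, M <= 1,
    \prod_(i <- s) g i <= M ^+ size s & M ^+ p <= \sum_(i <- s) g i ^+ p].
  have : (0 < size s)%N by exact: leq_trans ps.
  elim: s {ps} => // i s IH _; case: s IH => [_|j s IH].
    have /andP[? ?] := g01 i; exists (g i); split=> //; by rewrite big_seq1.
  have [//|M [M0 M1 Ms Mp]] := IH; have /andP[gi0 gi1] := g01 i.
  have prod0 l : 0 <= \prod_(i <- l) g i by apply: prodr_ge0.
  have sum0 l : 0 <= \sum_(i <- l) g i ^+ p.
    by apply: sumr_ge0 => k _; exact: exprn_ge0.
  exists (Num.max M (g i)); split.
  - by rewrite le_max M0.
  - by rewrite ge_max M1.
  - rewrite big_cons [size _]/= exprS ler_pM//; first by rewrite le_max lexx orbT.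
    by apply: (le_trans Ms); rewrite lerXn2r ?nnegrE// le_max ?M0 ?lexx.
  - rewrite big_cons; case: (leP M (g i)) => _; first by rewrite lerDl.
    by rewrite (le_trans Mp)// lerDr exprn_ge0.
by apply: le_trans Ms (le_trans _ Mp); exact: ler_wiXn2l.
Qed.

(** Substitute for [prod_le_sum_pow] when the word may be shorter than [p]: either the first factor
    is at most [e], or its p-th power divided by e^p exceeds 1. *)
Lemma prod_le_eps s g p (e : R) : (0 < size s)%N -> 0 < e ->
    (forall i, 0 <= g i <= 1) ->
  \prod_(i <- s) g i <= e + (e ^+ p)^-1 * \sum_(i <- s) g i ^+ p.
Proof.
case: s => // i s _ e0 g01; rewrite !big_cons; have /andP[gi0 gi1] := g01 i.
have /andP[s0 s1] := @prod_le1 s g g01.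
have S0 : 0 <= \sum_(i <- s) g i ^+ p.
  by apply: sumr_ge0 => j _; rewrite exprn_ge0//; have /andP[] := g01 j.
apply: (@le_trans _ _ (g i)); first by rewrite ler_piMr.
have ep0 : 0 < (e ^+ p)^-1 by rewrite invr_gt0 exprn_gt0.
have [ge|eg] := leP (g i) e.
  by rewrite (le_trans ge)// lerDl mulr_ge0// ?(ltW ep0)// addr_ge0// exprn_ge0.
apply: (@le_trans _ _ 1) => //.
apply: (@le_trans _ _ ((e ^+ p)^-1 * g i ^+ p)).
  rewrite ler_pdivlMl ?exprn_gt0// mulr1 lerXn2r// ?nnegrE ltW//.
rewrite -[leLHS]add0r lerD// ?(ltW e0)// ler_wpM2l ?(ltW ep0)// lerDl.
exact: S0.
Qed.

Lemma normc_prod_sub s (u v : I -> R[i]) :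
  (forall i, normc (u i) <= 1) -> (forall i, normc (v i) <= 1) ->
  normc (\prod_(i <- s) u i - \prod_(i <- s) v i) <= \sum_(i <- s) normc (u i - v i).
Proof.
move=> u1 v1; elim: s => [|i s IH]; first by rewrite !big_nil subrr normc0.
rewrite !big_cons.
have -> : u i * \prod_(j <- s) u j - v i * \prod_(j <- s) v j =
  (u i - v i) * \prod_(j <- s) u j + v i * (\prod_(j <- s) u j - \prod_(j <- s) v j).
  by ring.
apply: le_trans (le_normcD _ _) _; rewrite !normcM; apply: lerD.
  rewrite ler_piMr ?normc_ge0// normc_prod.
  by have /andP[] := @prod_le1 s (fun j => normc (u j))
    (fun j => introT andP (conj (normc_ge0 _) (u1 j))).
by apply: le_trans IH; rewrite ler_piMl ?normc_ge0.
Qed.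

Lemma normc_prodM_sub s (a u v : I -> R[i]) :
  (forall i, normc (u i) <= 1) -> (forall i, normc (v i) <= 1) ->
  normc (\prod_(i <- s) (a i * u i) - \prod_(i <- s) (a i * v i)) <=
  \prod_(i <- s) normc (a i) * \sum_(i <- s) normc (u i - v i).
Proof.
move=> u1 v1; rewrite !big_split -mulrBr normcM normc_prod /= ler_wpM2l//.
  by apply: prodr_ge0 => i _; exact: normc_ge0.
exact: normc_prod_sub.
Qed.

End ProductBounds.

(** Designed for one wave times two terms of the approximate solution: a product over three words
    has been majorized by a sum, which falls on one word at a time. *)
Lemma triple_sum_le (R : realType) (I1 I2 I3 : eqType) (s1 : seq I1) (s2 : seq I2) (s3 : seq I3)
    (w1 p1 y1 : I1 -> R) (w2 p2 y2 : I2 -> R) (w3 p3 y3 : I3 -> R) (B : R) :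
    (forall i, 0 <= w1 i) -> (forall i, 0 <= w2 i) -> (forall i, 0 <= w3 i) ->
    (forall i j k, i \in s1 -> j \in s2 -> k \in s3 ->
       p1 i * p2 j * p3 k <= B * (y1 i + y2 j + y3 k)) ->
  (\sum_(i <- s1) w1 i * p1 i) * (\sum_(j <- s2) w2 j * p2 j) * (\sum_(k <- s3) w3 k * p3 k) <=
  B * ((\sum_(i <- s1) w1 i * y1 i) * (\sum_(j <- s2) w2 j) * (\sum_(k <- s3) w3 k) +
       (\sum_(i <- s1) w1 i) * (\sum_(j <- s2) w2 j * y2 j) * (\sum_(k <- s3) w3 k) +
       (\sum_(i <- s1) w1 i) * (\sum_(j <- s2) w2 j) * (\sum_(k <- s3) w3 k * y3 k)).
Proof.
move=> w10 w20 w30 H.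
have E (f1 : I1 -> R) (f2 : I2 -> R) (f3 : I3 -> R) :
    (\sum_(i <- s1) f1 i) * (\sum_(j <- s2) f2 j) * (\sum_(k <- s3) f3 k) =
    \sum_(i <- s1) \sum_(j <- s2) \sum_(k <- s3) f1 i * f2 j * f3 k.
  rewrite big_distrlr /= mulr_suml; apply: eq_bigr => i _.
  by rewrite mulr_suml; apply: eq_bigr => j _; rewrite mulr_sumr.
rewrite !E -!big_split mulr_sumr /= big_seq [leRHS]big_seq; apply: ler_sum => i si.
rewrite -!big_split mulr_sumr /= big_seq [leRHS]big_seq; apply: ler_sum => j sj.
rewrite -!big_split mulr_sumr /= big_seq [leRHS]big_seq; apply: ler_sum => k sk.
have -> : w1 i * p1 i * (w2 j * p2 j) * (w3 k * p3 k) =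
  w1 i * w2 j * w3 k * (p1 i * p2 j * p3 k) by ring.
have -> : B * (w1 i * y1 i * w2 j * w3 k + w1 i * (w2 j * y2 j) * w3 k +
  w1 i * w2 j * (w3 k * y3 k)) = w1 i * w2 j * w3 k * (B * (y1 i + y2 j + y3 k)) by ring.
by apply: ler_wpM2l; [rewrite !mulr_ge0|exact: H].
Qed.

Section EsumBounds.
Variables (R : realType) (X : choiceType).
Implicit Types (f w : X -> R) (K : R).

Lemma esum_le_finite f K : (forall s : seq X, uniq s -> \sum_(x <- s) f x <= K) ->
  (\esum_(x in [set: X]) (f x)%:E <= K%:E)%E.
Proof.
move=> H; apply: ge_ereal_sup => _ [A [finA _] <-].
by rewrite fsbig_finite//= sumEFin lee_fin H.
Qed.

Lemma esum_ge_finite f (s : seq X) : uniq s -> (forall x, 0 <= f x) ->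
  ((\sum_(x <- s) f x)%:E <= \esum_(x in [set: X]) (f x)%:E)%E.
Proof.
move=> us f0; apply: esum_ge; exists [set` s]; first by split=> //; exact: finite_seq.
by rewrite -fsbig_seq// sumEFin.
Qed.

(** The majorant is the full infinite weighted sum, so it serves all finite subfamilies at once; by
    positivity its partial sums over [m] may be taken inside. *)
Lemma esum_weighted w K (Y : X -> nat -> R) (L : R) :
    (forall x, 0 <= w x) -> (forall x m, 0 <= Y x m) -> 0 <= L ->
    (forall s : seq X, uniq s -> \sum_(x <- s) w x <= K) ->
    (forall x M, \sum_(m < M) Y x m <= L) ->
  exists d : nat -> R, [/\ forall m, 0 <= d m, forall M, \sum_(m < M) d m <= K * L &
    forall m (s : seq X), uniq s -> \sum_(x <- s) w x * Y x m <= d m].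
Proof.
move=> w0 Y0 L0 wK YL.
have K0 : 0 <= K by have := wK [::] isT; rewrite big_nil.
pose D m := (\esum_(x in [set: X]) (w x * Y x m)%:E)%E.
have wY0 x m : 0 <= w x * Y x m by rewrite mulr_ge0.
have YLm x m : Y x m <= L.
  apply: le_trans (YL x m.+1); rewrite big_ord_recr /= lerDr sumr_ge0//.
have DK m : (D m <= (K * L)%:E)%E.
  apply: esum_le_finite => s us; apply: (@le_trans _ _ (\sum_(x <- s) w x * L)).
    by apply: ler_sum => x _; rewrite ler_wpM2l ?w0 ?YL ?YLm.
  by rewrite -mulr_suml ler_wpM2r// wK.
have Dfin m : D m \is a fin_num.
  rewrite ge0_fin_numE; first exact: le_lt_trans (DK m) (ltry _).
  by apply: esum_ge0 => x _; rewrite lee_fin.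
exists (fun m => fine (D m)); split.
- by move=> m; apply/fine_ge0/esum_ge0 => x _; rewrite lee_fin.
- move=> M; rewrite -lee_fin -sumEFin.
  rewrite (eq_bigr (fun m : 'I_M => D m)); last by move=> m _; rewrite fineK.
  rewrite -esum_sum; last by move=> x m _ _; rewrite lee_fin.
  under eq_esum do rewrite sumEFin -mulr_sumr.
  apply: esum_le_finite => s us; apply: (@le_trans _ _ (\sum_(x <- s) w x * L)).
    by apply: ler_sum => x _; rewrite ler_wpM2l ?w0 ?YL ?YLm.
  by rewrite -mulr_suml ler_wpM2r// wK.
- by move=> m s us; rewrite -lee_fin fineK//; exact: esum_ge_finite.
Qed.

End EsumBounds.

Lemma sum_ord_le (R : numDomainType) (n : nat) (f : 'I_n -> R) (K : R) :
  (forall i, f i <= K) -> \sum_i f i <= n%:R * K.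
Proof.
by move=> fK; rewrite mulr_natl -[n in leRHS]card_ord -sumr_const ler_sum.
Qed.

Section RiccatiBounds.
Variables (R : realType) (phi : nat -> R) (eta : R) (n : nat) (J : seq nat).
Variable C : nat -> R.
Hypothesis C0 : forall k, 0 <= C k.
Implicit Types (t : R) (q : seq nat * seq nat) (g y : nat -> R) (beta : nat -> R[i]).

Definition word_pairs (a : nat) : seq (seq nat * seq nat) :=
  [seq (ks, ls) | ks <- words J a.+1, ls <- words J a].

Definition pair_weight (a : nat) q : R :=
  `|heval phi eta a q.1 q.2| * \prod_(k <- q.1 ++ q.2) C k.

Lemma pair_weight_ge0 a q : 0 <= pair_weight a q.
Proof. by rewrite mulr_ge0// prodr_ge0. Qed.

Lemma size_word_pairs a q : q \in word_pairs a -> size (q.1 ++ q.2) = a.*2.+1.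
Proof.
move=> /allpairsP[[ks ls] [/=]]; rewrite !mem_words => /andP[/eqP sk _] /andP[/eqP sl _] ->.
by rewrite size_cat sk sl -addnn addSn.
Qed.

Lemma normc_riccati_term beta g a t : (forall k, normc (beta k) <= C k * g k) ->
  (forall k, 0 <= g k) ->
  normc (riccati_term phi eta J beta a t) <=
  \sum_(q <- word_pairs a) pair_weight a q * \prod_(k <- q.1 ++ q.2) g k.
Proof.
move=> bC g0; rewrite /word_pairs big_allpairs_dep /=.
apply: le_trans (normc_sum _ _ _) _; apply: ler_sum => ks _.
apply: le_trans (normc_sum _ _ _) _; apply: ler_sum => ls _.
rewrite normcM normc_real /pair_weight /= -mulrA -big_split ler_wpM2l//.
rewrite normcM !normc_prod big_cat /= ler_pM ?prodr_ge0//.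
- by move=> k _; exact: normc_ge0.
- by move=> k _; exact: normc_ge0.
- by apply: ler_prod => k _; rewrite normc_ge0 normc_wave bC.
- by apply: ler_prod => k _; rewrite normc_ge0 normcJ normc_wave bC.
Qed.

Lemma normc_riccati_term_sub (b u v : nat -> R[i]) y a t :
    (forall k, normc (b k) = C k) ->
    (forall k, normc (u k) <= 1) -> (forall k, normc (v k) <= 1) ->
    (forall k, normc (u k - v k) <= y k) ->
  normc (riccati_term phi eta J (fun k => b k * u k) a t -
         riccati_term phi eta J (fun k => b k * v k) a t) <=
  \sum_(q <- word_pairs a) pair_weight a q * \sum_(k <- q.1 ++ q.2) y k.
Proof.
move=> bC u1 v1 uv; rewrite /word_pairs big_allpairs_dep /= /riccati_term /word_sum -sumrB.
apply: le_trans (normc_sum _ _ _) _; apply: ler_sum => ks _; rewrite -sumrB.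
apply: le_trans (normc_sum _ _ _) _; apply: ler_sum => ls _.
rewrite -mulrBr normcM normc_real /pair_weight /= -mulrA ler_wpM2l//.
pose e k : R[i] := b k * expi (- phi k * t).
have ne k : normc (e k) = C k by rewrite normcM normc_expi mulr1.
have wE (x : nat -> R[i]) : \prod_(k <- ks) wave phi (fun k => b k * x k) k t *
    \prod_(l <- ls) conjc (wave phi (fun k => b k * x k) l t) =
    \prod_(k <- ks) (e k * x k) * \prod_(l <- ls) (conjc (e l) * conjc (x l)).
  by congr (_ * _); apply: eq_bigr => k _; rewrite /wave /e ?rmorphM /=; ring.
rewrite !wE.
have prod1 (x : nat -> R[i]) s : (forall k, normc (x k) <= 1) ->
    normc (\prod_(k <- s) (e k * x k)) <= \prod_(k <- s) C k.
  move=> x1; rewrite normc_prod; apply: ler_prod => k _.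
  by rewrite normc_ge0 normcM ne ler_piMr.
have -> (x1 x2 y1 y2 : R[i]) : x1 * y1 - x2 * y2 = (x1 - x2) * y1 + x2 * (y1 - y2) by ring.
apply: le_trans (le_normcD _ _) _; rewrite !normcM !big_cat mulrDr /= lerD//.
  apply: (@le_trans _ _ ((\prod_(k <- ks) C k * \sum_(k <- ks) y k) * \prod_(k <- ls) C k)).
    apply: ler_pM; rewrite ?normc_ge0//.
      apply: le_trans (normc_prodM_sub _ _ u1 v1) _.
      have -> : \prod_(i <- ks) normc (e i) = \prod_(i <- ks) C i.
        by apply: eq_bigr => k _; exact: ne.
      by rewrite ler_wpM2l ?prodr_ge0// ler_sum.
    rewrite normc_prod; apply: ler_prod => k _.
    by rewrite normc_ge0 normcM !normcJ ne ler_piMr.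
  by rewrite mulrAC.
rewrite -mulrA; apply: ler_pM; rewrite ?normc_ge0// ?prod1//.
have cu k : normc (conjc (u k)) <= 1 by rewrite normcJ.
have cv k : normc (conjc (v k)) <= 1 by rewrite normcJ.
apply: le_trans (normc_prodM_sub _ _ cu cv) _.
have -> : \prod_(i <- ls) normc (conjc (e i)) = \prod_(i <- ls) C i.
  by apply: eq_bigr => k _; rewrite normcJ ne.
rewrite ler_wpM2l ?prodr_ge0// ler_sum// => k _.
by rewrite -rmorphB normcJ.
Qed.

Variables (S d B : R) (y g : nat -> R) (p : nat).
Hypothesis S0 : 0 <= S.
Hypothesis B0 : 0 <= B.
Hypothesis y0 : forall k, 0 <= y k.
Hypothesis SC : \sum_(k <- J) C k <= S.
Hypothesis dC : \sum_(k <- J) C k * y k <= d.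
Hypothesis Sw : forall a, (a < n)%N -> \sum_(q <- word_pairs a) pair_weight a q <= S.
Hypothesis dw : forall a, (a < n)%N ->
  \sum_(q <- word_pairs a) pair_weight a q * \sum_(k <- q.1 ++ q.2) y k <= d.
Hypothesis g01 : forall k, 0 <= g k <= 1.
Hypothesis gy : forall k, g k ^+ p <= B * y k.

Let g0 k : 0 <= g k. Proof. by have /andP[] := g01 k. Qed.

(** Makes [riccati] small: [e] is chosen first to control the part that does not decay, and then [d]
    has to be small in terms of [e]. *)
Lemma normc_riccati_le beta (e : R) t : (forall k, normc (beta k) <= C k * g k) -> 0 < e ->
  normc (riccati phi eta n J beta t) <= n%:R * (e * S + (e ^+ p)^-1 * B * d).
Proof.
move=> bC e0; rewrite /riccati normcN; apply: le_trans (normc_sum _ _ _) _.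
apply: sum_ord_le => a.
apply: le_trans (normc_riccati_term _ _ bC g0) _.
apply: (@le_trans _ _ (\sum_(q <- word_pairs a) (e * pair_weight a q +
    (e ^+ p)^-1 * B * (pair_weight a q * \sum_(k <- q.1 ++ q.2) y k)))).
  rewrite big_seq [leRHS]big_seq; apply: ler_sum => q qa.
  have -> : e * pair_weight a q +
      (e ^+ p)^-1 * B * (pair_weight a q * \sum_(k <- q.1 ++ q.2) y k) =
    pair_weight a q * (e + (e ^+ p)^-1 * (B * \sum_(k <- q.1 ++ q.2) y k)) by ring.
  rewrite ler_wpM2l ?pair_weight_ge0//.
  apply: le_trans (prod_le_eps p _ e0 g01) _; first by rewrite (size_word_pairs qa).
  by rewrite lerD2l ler_wpM2l ?invr_ge0 ?exprn_ge0 ?(ltW e0)// mulr_sumr ler_sum.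
rewrite big_split -!mulr_sumr /= lerD// ler_wpM2l ?Sw ?dw ?(ltW e0)//.
by rewrite mulr_ge0// invr_ge0 exprn_ge0// ltW.
Qed.

Lemma normc_riccati_sub (b u v : nat -> R[i]) t : (forall k, normc (b k) = C k) ->
    (forall k, normc (u k) <= 1) -> (forall k, normc (v k) <= 1) ->
    (forall k, normc (u k - v k) <= y k) ->
  normc (riccati phi eta n J (fun k => b k * u k) t -
         riccati phi eta n J (fun k => b k * v k) t) <= n%:R * d.
Proof.
move=> bC u1 v1 uv; rewrite /riccati -opprD normcN -sumrB.
apply: le_trans (normc_sum _ _ _) _.
apply: sum_ord_le => a.
exact: le_trans (normc_riccati_term_sub _ _ bC u1 v1 uv) (dw (ltn_ord a)).
Qed.

Lemma normc_wave_riccati_rem beta t : (forall k, normc (beta k) <= C k * g k) ->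
    p = (n.*2.+1)%N ->
  normc (\sum_(k <- J) wave phi beta k t) * normc (riccati_rem phi eta n J beta t) <=
  n%:R * (n%:R * (3 * B * d * S ^+ 2)).
Proof.
move=> bC pn.
have d0 : 0 <= d by apply: le_trans dC; apply: sumr_ge0 => k _; rewrite mulr_ge0.
set F := \sum_(k <- J) _.
have FC : normc F <= \sum_(k <- J) C k * g k.
  apply: le_trans (normc_sum _ _ _) _; apply: ler_sum => k _.
  by rewrite normc_wave.
rewrite /riccati_rem.
apply: (@le_trans _ _ (\sum_(b < n) \sum_(b' < n | ~~ (b + b' + 1 < n)%N)
    3 * B * d * S ^+ 2)); last first.
  apply: sum_ord_le => b.
  rewrite big_mkcond; apply: sum_ord_le => b'; case: ifP => // _.
  by rewrite !mulr_ge0// exprn_ge0.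
apply: (@le_trans _ _ (normc F * \sum_(b < n) \sum_(b' < n | ~~ (b + b' + 1 < n)%N)
   normc (riccati_term phi eta J beta b t * riccati_term phi eta J beta b' t))).
  rewrite ler_wpM2l ?normc_ge0//; apply: le_trans (normc_sum _ _ _) _.
  by apply: ler_sum => b _; exact: normc_sum.
rewrite mulr_sumr; apply: ler_sum => b _; rewrite mulr_sumr; apply: ler_sum => b' bb'.
rewrite normcM mulrA.
pose P (a : nat) := \sum_(q <- word_pairs a) pair_weight a q * \prod_(k <- q.1 ++ q.2) g k.
apply: (@le_trans _ _ ((\sum_(k <- J) C k * g k) * P b * P b')).
  by rewrite !ler_pM ?mulr_ge0 ?normc_ge0 ?normc_riccati_term.
have := @triple_sum_le R _ _ _ J (word_pairs b) (word_pairs b') C g y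
  (pair_weight b) (fun q => \prod_(k <- q.1 ++ q.2) g k) (fun q => \sum_(k <- q.1 ++ q.2) y k)
  (pair_weight b') (fun q => \prod_(k <- q.1 ++ q.2) g k) (fun q => \sum_(k <- q.1 ++ q.2) y k)
  B C0 (pair_weight_ge0 b) (pair_weight_ge0 b').
move=> /(_ _)/le_trans; apply.
  move=> k q q' _ qb qb'.
  have := @prod_le_sum_pow R nat (k :: (q.1 ++ q.2) ++ (q'.1 ++ q'.2)) g p _ g01.
  rewrite [size _]/= size_cat (size_word_pairs qb) (size_word_pairs qb').
  (* The letter of the wave and the two words have 2 (b + b' + 1) + 1 letters together, at least 2n
     + 1 = p because the pair belongs to the remainder. *)
  have -> : (0 < p <= (b.*2.+1 + b'.*2.+1).+1)%N by lia.
  move=> /(_ isT); rewrite !big_cons !(big_cat _ (q.1 ++ q.2)) /= mulrA => /le_trans; apply.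
  rewrite !mulrDr -addrA lerD ?gy// lerD// mulr_sumr ler_sum// => j _; exact: gy.
have Sb := Sw (ltn_ord b); have Sb' := Sw (ltn_ord b').
have db := dw (ltn_ord b); have db' := dw (ltn_ord b').
have W0 a : 0 <= \sum_(q <- word_pairs a) pair_weight a q.
  by apply: sumr_ge0 => q _; exact: pair_weight_ge0.
have V0 a : 0 <= \sum_(q <- word_pairs a) pair_weight a q * \sum_(k <- q.1 ++ q.2) y k.
  by apply: sumr_ge0 => q _; rewrite mulr_ge0 ?pair_weight_ge0// sumr_ge0.
have C'0 : 0 <= \sum_(k <- J) C k by rewrite sumr_ge0.
have Cy0 : 0 <= \sum_(k <- J) C k * y k by rewrite sumr_ge0// => k _; rewrite mulr_ge0.
have -> : 3 * B * d * S ^+ 2 = B * (d * S * S + S * d * S + S * S * d) by ring.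
by rewrite ler_wpM2l// !lerD// !ler_pM// mulr_ge0.
Qed.

End RiccatiBounds.

Section Weights.
Variables (R : realType) (c : nat -> R[i]) (phi : nat -> R) (eta : R).
Implicit Types (a n m M : nat) (J : seq nat).

Lemma seq_of_tuples n (s : seq (seq nat)) : {in s, forall x, size x = n} ->
  exists tl : seq (n.-tuple nat), s = map val tl.
Proof.
elim: s => [|x s IH] H; first by exists [::].
have [|tl ->] := IH; first by move=> z zs; apply: H; rewrite inE zs orbT.
have /eqP sx : size x = n by apply: H; rewrite mem_head.
by exists (Tuple sx :: tl).
Qed.

Lemma words_tuples n J : uniq J ->
  exists2 tl : seq (n.-tuple nat), uniq tl & words J n = map val tl.
Proof.
move=> uJ; have [|tl E] := @seq_of_tuples n (words J n).
  by move=> x; rewrite mem_words => /andP[/eqP].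
by exists tl => //; rewrite -(map_inj_uniq val_inj) -E words_uniq.
Qed.

Lemma hterm_ge0 I ks ls : (0 <= hterm c phi eta I ks ls)%E.
Proof.
by rewrite /hterm; case: ifP => // _; case: ifP => // _; rewrite lee_fin normc_ge0.
Qed.

(** With nonzero coefficients a pole would make the term infinite, so finiteness yields regularity.
    The scaling by [T] comes out once per letter. *)
Lemma hterm_regular a (ks ls : seq nat) (T : R) : 0 <= T ->
    size ks = a.+1 -> size ls = a ->
    {in ks ++ ls, forall k, c k != 0} -> (hterm c phi eta a.*2.+1 ks ls < +oo)%E ->
  ~~ is_pole (hfun a.*2.+1 (map phi ks) (map phi ls)) eta /\
  pair_weight phi eta (fun k => T * normc (c k)) a (ks, ls) =
    T ^+ a.*2.+1 * fine (hterm c phi eta a.*2.+1 ks ls).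
Proof.
move=> T0 sk sl cn0; rewrite /hterm.
have prod_neq0 (s : seq nat) (f : nat -> R[i]) : {in s, forall k, f k != 0} ->
    \prod_(k <- s) f k != 0.
  by move=> H; rewrite prodf_seq_neq0; apply/allP => k ks'; rewrite H.
rewrite ifF; last first.
  apply/negbTE; rewrite mulf_neq0// prod_neq0// => k kl.
    by apply: cn0; rewrite mem_cat kl.
  by rewrite conjc_eq0; apply: cn0; rewrite mem_cat kl orbT.
case: ifP => // np _; split=> //.
rewrite /pair_weight /= !normcM normc_real !normc_prod mulrCA; congr (_ * _).
have cst (s : seq nat) : \prod_(k <- s) T = T ^+ size s.
  by rewrite big_const_seq count_predT iter_mulr_1.
rewrite big_cat !big_split /= !cst sk sl -addnn -addSn exprD.
have -> : \prod_(i <- ls) normc (conjc (c i)) = \prod_(i <- ls) normc (c i).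
  by apply: eq_bigr => i _; exact: normcJ.
by ring.
Qed.

(** The order of quantifiers is the point: [S], [d] and [D] are fixed before [J], being taken from
    sums over all tuples. *)
Lemma word_pairs_weights a (T L : R) (y : nat -> nat -> R) : 0 <= T -> 0 <= L ->
    (forall k m, 0 <= y k m) -> (forall k M, \sum_(m < M) y k m <= L) ->
    (\esum_(kl in [set: a.+1.-tuple nat * a.-tuple nat])
       hterm c phi eta a.*2.+1 kl.1 kl.2 < +oo)%E ->
  exists S : R, exists d : nat -> R, exists D : R,
    [/\ 0 <= S, forall m, 0 <= d m, forall M, \sum_(m < M) d m <= D &
    forall J, uniq J -> {in J, forall k, c k != 0} ->
    [/\ forall ks ls, ks \in words J a.+1 -> ls \in words J a ->
          ~~ is_pole (hfun a.*2.+1 (map phi ks) (map phi ls)) eta,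
        \sum_(q <- word_pairs J a) pair_weight phi eta (fun k => T * normc (c k)) a q <= S &
        forall m, \sum_(q <- word_pairs J a) pair_weight phi eta (fun k => T * normc (c k)) a q *
          \sum_(k <- q.1 ++ q.2) y k m <= d m]].
Proof.
move=> T0 L0 y0 yL; pose X := (a.+1.-tuple nat * a.-tuple nat)%type.
pose h (x : X) := hterm c phi eta a.*2.+1 x.1 x.2.
rewrite -/(h _) => hfin.
have h0 x : (0 <= h x)%E by exact: hterm_ge0.
have hoo x : (h x < +oo)%E.
  apply: le_lt_trans hfin; apply: esum_ge; exists [set x]; first by split.
  by rewrite fsbig_set1.
have hE x : (fine (h x))%:E = h x by rewrite fineK// ge0_fin_numE.
pose E := fine (\esum_(x in [set: X]) h x)%E.
have EE : (\esum_(x in [set: X]) h x)%E = E%:E.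
  by rewrite fineK// ge0_fin_numE// esum_ge0.
pose w (x : X) := T ^+ a.*2.+1 * fine (h x).
have w0 x : 0 <= w x by rewrite mulr_ge0 ?exprn_ge0// fine_ge0.
have wK (s : seq X) : uniq s -> \sum_(x <- s) w x <= T ^+ a.*2.+1 * E.
  move=> us; rewrite -mulr_sumr ler_wpM2l ?exprn_ge0// -lee_fin -EE.
  apply: le_trans (esum_ge_finite us _) _; first by move=> x; exact: fine_ge0.
  by rewrite le_eqVlt; apply/predU1P; left; apply: eq_esum => x _; exact: hE.
pose Y (x : X) m := \sum_(k <- val x.1 ++ val x.2) y k m.
have Y0 x m : 0 <= Y x m by exact: sumr_ge0.
have YL x M : \sum_(m < M) Y x m <= a.*2.+1%:R * L.
  rewrite exchange_big /=; apply: (@le_trans _ _ (\sum_(k <- val x.1 ++ val x.2) L)).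
    by apply: ler_sum => k _; exact: yL.
  rewrite big_const_seq count_predT size_cat !size_tuple -addnn addSn iter_addr_0.
  by rewrite mulr_natl.
have [|d [d0 dD dw]] := esum_weighted w0 Y0 _ wK YL; first by rewrite mulr_ge0.
exists (T ^+ a.*2.+1 * E), d, (T ^+ a.*2.+1 * E * (a.*2.+1%:R * L)); split=> //.
  by rewrite mulr_ge0 ?exprn_ge0// fine_ge0// esum_ge0.
move=> J uJ Jc.
have [tk utk Ek] := words_tuples a.+1 uJ; have [tl utl El] := words_tuples a uJ.
have reg (t : a.+1.-tuple nat) (l : a.-tuple nat) : val t \in words J a.+1 -> val l \in words J a ->
    ~~ is_pole (hfun a.*2.+1 (map phi t) (map phi l)) eta /\
    pair_weight phi eta (fun k => T * normc (c k)) a (val t, val l) = w (t, l).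
  rewrite !mem_words => /andP[_ /allP tJ] /andP[_ /allP lJ].
  apply: hterm_regular; rewrite ?size_tuple//; last exact: (hoo (t, l)).
  by move=> k; rewrite mem_cat => /orP[/tJ|/lJ]; exact: Jc.
pose tp := [seq (t, l) | t <- tk, l <- tl].
have utp : uniq tp by apply: allpairs_uniq => // -[? ?] [? ?] _ _ [-> ->].
have wp (f : seq nat * seq nat -> R) : \sum_(q <- word_pairs J a) f q =
    \sum_(x <- tp) f (val x.1, val x.2).
  rewrite /word_pairs /tp big_allpairs_dep [RHS]big_allpairs_dep Ek El big_map; apply: eq_bigr => t _.
  by rewrite big_map.
have tpE x : x \in tp ->
    pair_weight phi eta (fun k => T * normc (c k)) a (val x.1, val x.2) = w x.
  move=> /allpairsP[[t l] [/= tt ll ->]].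
  by have [] := reg t l; rewrite ?Ek ?El ?map_f.
split.
- move=> ks ls kJ lJ; have := kJ; have := lJ; rewrite {1}El => /mapP[l _ lE]; rewrite {1}Ek => /mapP[t _ tE].
  by rewrite tE lE; have [] := reg t l; rewrite -?tE -?lE.
- by rewrite wp (eq_big_seq w)// wK.
- move=> m; rewrite wp; apply: le_trans (dw m tp utp).
  by rewrite big_seq [leRHS]big_seq ler_sum// => x xtp; rewrite tpE.
Qed.

End Weights.

(** * Growth of solutions *)

Section DiracQuadratic.
Variables (R : realType) (varphi : R -> R[i]) (eta : R) (U : R -> 'cV[R[i]]_2).
Hypothesis Usol : Dirac_solution varphi (eta / 2) U.
Local Notation mu := (@lebesgue_measure R).
Local Notation f1 x := (complex.Re (varphi x)).
Local Notation f2 x := (complex.Im (varphi x)).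

Definition dirac_b (t : R) : R[i] := U t 1 0 * conjc (U t 0 0).

(** Written as the real part of a complex expression so that the complex rules supply its derivative
    and its absolute continuity. *)
Definition dirac_a (t : R) : R :=
  complex.Re (U t 0 0 * conjc (U t 0 0) + U t 1 0 * conjc (U t 1 0)).

Lemma dirac_aE (t : R) : dirac_a t = normc (U t 0 0) ^+ 2 + normc (U t 1 0) ^+ 2.
Proof. by rewrite /dirac_a !normc_sqr ReD !ReM !ReJ !ImJ; ring. Qed.

Lemma dirac_a_ge0 t : 0 <= dirac_a t.
Proof. by rewrite dirac_aE addr_ge0 ?sqr_ge0. Qed.

Lemma dirac_b_le t :
  4 * (complex.Re (dirac_b t) ^+ 2 + complex.Im (dirac_b t) ^+ 2) <= dirac_a t ^+ 2.
Proof.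
rewrite -normc_sqr dirac_aE /dirac_b normcM normcJ -subr_ge0.
set x := normc (U t 0 0); set y := normc (U t 1 0).
have -> : (x ^+ 2 + y ^+ 2) ^+ 2 - 4 * (y * x) ^+ 2 = (x ^+ 2 - y ^+ 2) ^+ 2 by ring.
exact: sqr_ge0.
Qed.

Lemma cacont_dirac r a b : 0 < a -> a <= b -> cacont a b (fun t => U t r 0).
Proof.
move=> a0 ab; have [ac _] := Usol.
by split=> e /(ac r a b a0 ab)[d d0 H]; exists d => // n x y xy tI xyd;
  apply: le_lt_trans (H n x y xy tI xyd); apply: ler_sum => i _;
  rewrite -?ReN -?ReD -?ImN -?ImD ?Re_le_normc ?Im_le_normc.
Qed.

Lemma cacont_dirac_b a b : 0 < a -> a <= b -> cacont a b dirac_b.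
Proof.
move=> a0 ab; apply: cacontM; first exact: cacont_dirac.
by apply: cacontJ; exact: cacont_dirac.
Qed.

Lemma acont_dirac_a a b : 0 < a -> a <= b -> acont a b dirac_a.
Proof.
move=> a0 ab; have c r := cacont_dirac r a0 ab.
by have [] := cacontD (cacontM (c 0) (cacontJ (c 0))) (cacontM (c 1) (cacontJ (c 1))).
Qed.

Definition dirac_ode (x : R) :=
  is_cderive x (fun t => U t 0 0)
    (- 'i%C * (eta / 2)%:C * U x 0 0 + 'i%C * varphi x * U x 1 0) /\
  is_cderive x (fun t => U t 1 0)
    ('i%C * (eta / 2)%:C * U x 1 0 - 'i%C * conjc (varphi x) * U x 0 0).

Lemma dirac_ode_ae : exists2 N : set R, mu.-negligible N &
  forall x, 0 < x -> ~ N x -> dirac_ode x.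
Proof.
have [_ ae] := Usol; exists (~` [set x | 0 < x ->
    (forall r, cderivable (fun t => U t r 0) x) /\
    Lambda varphi U x = (eta / 2)%:C *: U x]) => // x x0.
rewrite /setC /= => /contrapT /(_ x0) [dU LU].
have cd r : is_cderive x (fun t => U t r 0) (cderive (fun t => U t r 0) x).
  have [d1 d2] := dU r; split; rewrite /cderive /= derive1E.
    exact: DeriveDef.
  exact: DeriveDef.
have i2 : 'i%C * 'i%C = -1 :> R[i] by rewrite -expr2 sqr_i.
have L0 := congr1 (fun M : 'cV[R[i]]_2 => M 0 0) LU.
have L1 := congr1 (fun M : 'cV[R[i]]_2 => M 1 0) LU.
move: L0 L1; rewrite /Lambda !mxE !big_ord_recl !big_ord0 !mxE /=.
rewrite !mul0r !addr0 !add0r => L0 L1.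
have e0 : ord0 = 0 :> 'I_2 by exact: val_inj.
have e1 : lift ord0 ord0 = 1 :> 'I_2 by exact: val_inj.
move: L0 L1; rewrite e0 e1; move: (cd 0) (cd 1).
set D0 := cderive _ _; set D1 := cderive _ _ => c0 c1 L0 L1.
split.
  apply: is_cderive_eq c0 _.
  have -> : D0 = - 'i%C * ('i%C * D0) by rewrite mulrA mulNr i2 opprK mul1r.
  have -> : 'i%C * D0 = (eta / 2)%:C * U x 0 0 - varphi x * U x 1 0 by rewrite -L0 addrK.
  by ring.
apply: is_cderive_eq c1 _.
have mi : (-1)*i = - 'i%C :> R[i] by rewrite /= /GRing.opp /= oppr0.
have -> : D1 = 'i%C * ((-1)*i * D1) by rewrite mi mulrA mulrN i2 opprK mul1r.
have -> : (-1)*i * D1 = (eta / 2)%:C * U x 1 0 - conjc (varphi x) * U x 0 0.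
  by rewrite -L1 addrK.
by ring.
Qed.

Lemma dirac_quadratic_derive (x : R) : dirac_ode x ->
  [/\ is_derive x 1 dirac_a (- 4 * (f1 x * complex.Im (dirac_b x) + f2 x * complex.Re (dirac_b x))),
      is_derive x 1 (fun t => complex.Re (dirac_b t))
        (- eta * complex.Im (dirac_b x) - f2 x * dirac_a x) &
      is_derive x 1 (fun t => complex.Im (dirac_b t))
        (eta * complex.Re (dirac_b x) - f1 x * dirac_a x)].
Proof.
move=> [d0 d1].
have [da _] := is_cderiveD (is_cderiveM d0 (is_cderiveJ d0)) (is_cderiveM d1 (is_cderiveJ d1)).
have [db1 db2] := is_cderiveM d1 (is_cderiveJ d0).
split.
- apply: is_derive_eq da _; rewrite /dirac_b.
  move: (U x 0 0) (U x 1 0) (varphi x) => [p q] [r s] [u v] /=; by field.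
- apply: is_derive_eq db1 _; rewrite /dirac_b /dirac_a.
  move: (U x 0 0) (U x 1 0) (varphi x) => [p q] [r s] [u v] /=; by field.
- apply: is_derive_eq db2 _; rewrite /dirac_b /dirac_a.
  move: (U x 0 0) (U x 1 0) (varphi x) => [p q] [r s] [u v] /=; by field.
Qed.

End DiracQuadratic.

Section IntervalStep.
Variables (R : realType) (varphi : R -> R[i]) (eta : R) (U : R -> 'cV[R[i]]_2).
Hypothesis Usol : Dirac_solution varphi (eta / 2) U.

Definition dirac_lyap (r : R -> R[i]) (t : R) : R :=
  lyap (dirac_a U t) (complex.Re (dirac_b U t)) (complex.Im (dirac_b U t))
    (complex.Re (r t)) (complex.Im (r t)).

Lemma sqr_Re_Im_le (z : R[i]) : normc z <= 1 / 2 ->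
  complex.Re z ^+ 2 + complex.Im z ^+ 2 <= 1 / 4.
Proof.
move=> z2; have -> : 1 / 4 = (1 / 2) ^+ 2 :> R by field.
by rewrite -normc_sqr lerXn2r ?nnegrE ?normc_ge0 ?divr_ge0.
Qed.

Lemma dirac_lyap_bounds (r : R -> R[i]) (t : R) : normc (r t) <= 1 / 2 ->
  dirac_a U t <= 3 * dirac_lyap r t /\ dirac_lyap r t <= 3 * dirac_a U t.
Proof.
move=> /sqr_Re_Im_le; apply: lyap_bounds; [exact: dirac_a_ge0|exact: dirac_b_le].
Qed.

Lemma dirac_lyap_jump (r r' : R -> R[i]) (t d : R) :
    normc (r t) <= 1 / 2 -> normc (r' t) <= 1 / 2 -> normc (r t - r' t) <= d ->
  dirac_lyap r t <= (1 + 27 * d) * dirac_lyap r' t.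
Proof.
move=> hr hr' hd; have d0 : 0 <= d by apply: le_trans hd; exact: normc_ge0.
apply: lyap_jump; rewrite ?dirac_a_ge0 ?dirac_b_le ?sqr_Re_Im_le//.
by rewrite -!ReN -!ImN -ReD -ImD -normc_sqr lerXn2r ?nnegrE ?normc_ge0.
Qed.

Lemma acont_dirac_lyap (r : R -> R[i]) (a b : R) : 0 < a -> a <= b ->
    cacont a b r -> (forall t, normc (r t) <= 1 / 2) ->
  acont a b (dirac_lyap r).
Proof.
move=> a0 ab [r1 r2] hr; have [b1 b2] := cacont_dirac_b Usol a0 ab.
have da := acont_dirac_a Usol a0 ab.
have ds := acontD (acontM r1 r1) (acontM r2 r2).
have dN := acontD (acontM (acontD (acont_cst a b 1) ds) da)
  (acontN (acontM (acont_cst a b 4) (acontD (acontM r1 b1) (acontN (acontM r2 b2))))).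
apply: (acontM dN (acontV (m := 3 / 4) _ _ (acontD (acont_cst a b 1) (acontN ds)))).
  by lra.
move=> t _; have := sqr_Re_Im_le (hr t); rewrite !expr2; lra.
Qed.

Lemma riccati_error_le (A z G w : R[i]) : normc z ^+ 2 <= 1 ->
  normc (- 'i%C * A - 'i%C * conjc A * z ^+ 2 + 'i%C * conjc G * w) <=
  2 * normc A + normc G * normc w.
Proof.
move=> z1; apply: le_trans (le_normcD _ _) _; rewrite !normcM normc_i mul1r normcJ lerD2r.
apply: le_trans (le_normcD _ _) _; rewrite !normcN !normcM !normcN normc_i !mul1r normcJ.
by rewrite mulrDl mul1r lerD2l -[leRHS]mulr1 ler_wpM2l ?normc_ge0.
Qed.

Variables (phi : nat -> R) (n : nat) (J : seq nat) (beta : nat -> R[i]).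
Hypothesis n0 : (0 < n)%N.
Hypothesis regJ : forall a ks ls, (a < n)%N -> ks \in words J a.+1 -> ls \in words J a ->
  ~~ is_pole (hfun a.*2.+1 (map phi ks) (map phi ls)) eta.
Local Notation r := (riccati phi eta n J beta).
Local Notation F t := (\sum_(k <- J) wave phi beta k t).
Hypothesis hr : forall t, normc (r t) <= 1 / 2.

Lemma dirac_lyap_growth (a b K : R) : 0 < a -> a <= b ->
    (forall t, a <= t <= b -> 2 * normc (F t - varphi t) +
       normc (F t) * normc (riccati_rem phi eta n J beta t) <= K) ->
  dirac_lyap r b <= expR (30 * K * (b - a)) * dirac_lyap r a.
Proof.
move=> a0 ab hK; have [N N0 ode] := dirac_ode_ae Usol.
have := acont_dirac_lyap a0 ab (cacont_riccati phi eta n J beta a b) hr.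
move=> /acont_gronwall; move=> /(_ (30 * K) N ab N0); apply.
move=> x /andP[ax xb] Nx; have x0 : 0 < x by exact: lt_le_trans ax.
have [da db1 db2] := dirac_quadratic_derive (ode x x0 Nx).
(* The defect of [r] in the Riccati equation with the true potential: two terms from replacing
   [varphi] by [F], one from the truncation at order [n]. *)
pose e : R[i] := - 'i%C * (F x - varphi x) - 'i%C * conjc (F x - varphi x) * r x ^+ 2
  + 'i%C * conjc (F x) * riccati_rem phi eta n J beta x.
have dr : is_cderive x r (- 'i%C * eta%:C * r x + 'i%C * varphi x
    + 'i%C * conjc (varphi x) * r x ^+ 2 - e).
  apply: is_cderive_eq (is_cderive_riccati beta regJ x n0) _.
  by rewrite /e rmorphB /=; ring.
have r4 : normc (r x) ^+ 2 <= 1.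
  by rewrite normc_sqr (le_trans (sqr_Re_Im_le (hr x)))//; lra.
have eK : normc e <= K.
  apply: le_trans (hK x _); last by rewrite ax.
  exact: riccati_error_le.
have K0 : 0 <= K by apply: le_trans eK; exact: normc_ge0.
have e2 : complex.Re e ^+ 2 + complex.Im e ^+ 2 <= K ^+ 2.
  by rewrite -normc_sqr lerXn2r ?nnegrE ?normc_ge0.
case: dr => dr1 dr2.
apply: (lyap_derive (dirac_a_ge0 U x) (dirac_b_le U x) (sqr_Re_Im_le (hr x)) K0 e2
  da db1 db2).
- apply: is_derive_eq dr1 _; clear.
  by move: (r x) (varphi x) e => [p q] [f g] [u v]; rewrite expr2 /=; ring.
- apply: is_derive_eq dr2 _; clear.
  by move: (r x) (varphi x) e => [p q] [f g] [u v]; rewrite expr2 /=; ring.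
Qed.

End IntervalStep.

Section Growth.
Variables (R : realType) (varphi : R -> R[i]) (eta : R) (U : R -> 'cV[R[i]]_2).
Hypothesis Usol : Dirac_solution varphi (eta / 2) U.
Variables (phi : nat -> R) (n p : nat) (J : seq nat) (b : nat -> R[i]) (u : nat -> nat -> R[i]).
Variables (y : nat -> nat -> R) (S B D e delta : R) (d : nat -> R) (m0 : nat).
Local Notation C := (fun k => normc (b k)).
Hypothesis n0 : (0 < n)%N.
Hypothesis pn : p = n.*2.+1.
Hypothesis u1 : forall m k, normc (u m k) <= 1.
Hypothesis uy : forall m k, normc (u m.+1 k - u m k) <= y k m.
Hypothesis up : forall m k, normc (u m k) ^+ p <= B * y k m.
Hypothesis S0 : 0 <= S.
Hypothesis B0 : 0 <= B.
Hypothesis d0 : forall m, 0 <= d m.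
Hypothesis dD : forall M, \sum_(m < M) d m <= D.
Hypothesis regJ : forall a ks ls, (a < n)%N -> ks \in words J a.+1 -> ls \in words J a ->
  ~~ is_pole (hfun a.*2.+1 (map phi ks) (map phi ls)) eta.
Hypothesis SC : \sum_(k <- J) C k <= S.
Hypothesis dC : forall m, \sum_(k <- J) C k * y k m <= d m.
Hypothesis Sw : forall a, (a < n)%N ->
  \sum_(q <- word_pairs J a) pair_weight phi eta C a q <= S.
Hypothesis dw : forall a m, (a < n)%N ->
  \sum_(q <- word_pairs J a) pair_weight phi eta C a q * \sum_(k <- q.1 ++ q.2) y k m <= d m.
Hypothesis e0 : 0 < e.
Hypothesis small : forall m, (m0 <= m)%N ->
  n%:R * (e * S + (e ^+ p)^-1 * B * d m) <= 1 / 2.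
Hypothesis delta0 : 0 <= delta.
Hypothesis varphi_close : forall m t, m.+1%:R <= t <= m.+2%:R ->
  normc (\sum_(k <- J) wave phi (fun k => b k * u m k) k t - varphi t) <= d m + delta.

Local Notation r m := (riccati phi eta n J (fun k => b k * u m k)).
Local Notation G m := (dirac_lyap U (r m)).

Let y0 k m : 0 <= y k m.
Proof. exact: le_trans (normc_ge0 _) (uy m k). Qed.

Let C0 k : 0 <= C k.
Proof. exact: normc_ge0. Qed.

Let g01 m k : 0 <= normc (u m k) <= 1.
Proof. by rewrite normc_ge0 u1. Qed.

Let bu m k : normc (b k * u m k) <= C k * normc (u m k).
Proof. by rewrite normcM. Qed.

Lemma riccati_small m t : (m0 <= m)%N -> normc (r m t) <= 1 / 2.
Proof.
move=> mm; apply: le_trans (small mm).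
apply: (normc_riccati_le C0 (y := y ^~ m) (g := fun k => normc (u m k))) => //.
by move=> a an; exact: dw.
Qed.

(** Growth exponent per unit of [d m]: 30 is the rate in [lyap_derive], applied to the freezing and
    truncation errors, and 27 the constant of [lyap_jump], applied to a jump of size at most
    [n * d m]. *)
Definition step_const : R := 30 * (2 + n%:R * (n%:R * (3 * B * S ^+ 2))) + 27 * n%:R.

Let kappa0 : 0 <= step_const.
Proof. by rewrite /step_const addr_ge0 ?mulr_ge0 ?addr_ge0 ?mulr_ge0 ?exprn_ge0. Qed.

Let X1 := 2 + n%:R * (n%:R * (3 * B * S ^+ 2)).

Lemma dirac_lyap_within m t : (m0 <= m)%N -> m.+1%:R <= t <= m.+2%:R ->
  G m t <= expR (30 * (X1 * d m + 2 * delta)) * G m m.+1%:R.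
Proof.
move=> mm /andP[mt tm]; have m1 : 0 < m.+1%:R :> R by [].
have Gm0 : 0 <= G m m.+1%:R.
  have [h _] := dirac_lyap_bounds U (riccati_small m.+1%:R mm).
  by have := dirac_a_ge0 U m.+1%:R; lra.
have X0 : 0 <= X1 * d m + 2 * delta.
  by rewrite addr_ge0 ?mulr_ge0 ?addr_ge0 ?mulr_ge0 ?exprn_ge0.
apply: (le_trans (dirac_lyap_growth Usol n0 regJ (fun s => riccati_small s mm) m1 mt
  (K := X1 * d m + 2 * delta) _)).
  move=> s /andP[ms st].
  have := normc_wave_riccati_rem C0 S0 B0 (y0 ^~ m) SC (dC m) Sw (fun a => @dw a m)
    (g01 m) (up m) s (bu m) pn.
  have : normc (\sum_(k <- J) wave phi (fun k => b k * u m k) k s - varphi s) <= d m + delta.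
    by apply: varphi_close; rewrite ms (le_trans st).
  rewrite /X1; nra.
rewrite ler_wpM2r// ler_expR ler_piMr ?mulr_ge0// lerBlDr nat1r.
exact: tm.
Qed.

(** The coefficients are exchanged at the right end m + 2, so the jump factor 1 + 27 n d follows the
    growth on the interval; it is absorbed by 1 + x <= exp x. *)
Lemma dirac_lyap_step m : (m0 <= m)%N ->
  G m.+1 m.+2%:R <= expR (step_const * d m + 60 * delta) * G m m.+1%:R.
Proof.
move=> mm; have mm' : (m0 <= m.+1)%N by exact: leqW.
have jump : normc (r m.+1 m.+2%:R - r m m.+2%:R) <= n%:R * d m.
  exact: (@normc_riccati_sub _ _ _ _ _ _ C0 (d m) (y ^~ m) (fun a => @dw a m) b).
apply: le_trans (dirac_lyap_jump U (riccati_small _ mm') (riccati_small _ mm) jump) _.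
have within : G m m.+2%:R <= expR (30 * (X1 * d m + 2 * delta)) * G m m.+1%:R.
  by apply: dirac_lyap_within => //; rewrite lexx ler_nat leqnSn.
have -> : step_const * d m + 60 * delta =
  27 * (n%:R * d m) + 30 * (X1 * d m + 2 * delta) by rewrite /step_const /X1; ring.
rewrite expRD -mulrA ler_pM//.
- by rewrite addr_ge0 ?mulr_ge0.
- have [h _] := dirac_lyap_bounds U (riccati_small m.+2%:R mm).
  by have := dirac_a_ge0 U m.+2%:R; lra.
- exact: expR_ge1Dx.
Qed.

Lemma dirac_lyap_iter i :
  G (m0 + i) (m0 + i).+1%:R <=
  expR (step_const * (\sum_(j < i) d (m0 + j)) + 60 * delta * i%:R) * G m0 m0.+1%:R.
Proof.
elim: i => [|i IH]; first by rewrite addn0 big_ord0 !mulr0 addr0 expR0 mul1r.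
rewrite addnS; apply: le_trans (dirac_lyap_step (leq_addr _ _)) _.
apply: le_trans (ler_wpM2l (expR_ge0 _) IH) _.
rewrite mulrA -expRD big_ord_recr /= -[i.+1%:R]natr1.
set s := \sum_(j < i) _.
have -> : step_const * (s + d (m0 + i)%N) + 60 * delta * (i%:R + 1) =
  step_const * d (m0 + i)%N + 60 * delta + (step_const * s + 60 * delta * i%:R) by ring.
by [].
Qed.

Lemma dirac_a_growth i t : (m0 + i).+1%:R <= t <= (m0 + i).+2%:R ->
  dirac_a U t <= 9 * expR (step_const * D + 60 * delta * i.+1%:R) * dirac_a U m0.+1%:R.
Proof.
move=> it; have mi : (m0 <= m0 + i)%N by exact: leq_addr.
have [h1 _] := dirac_lyap_bounds U (riccati_small t mi).
have [_ h2] := dirac_lyap_bounds U (riccati_small m0.+1%:R (leqnn m0)).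
have h3 := dirac_lyap_within mi it; have h4 := dirac_lyap_iter i.
apply: le_trans h1 _.
(* One factor 3 passes from [a] to the quadratic form at [t], the other back at the starting time;
   the interval containing [t] adds the last [60 * delta]. *)
have -> : 9 * expR (step_const * D + 60 * delta * i.+1%:R) * dirac_a U m0.+1%:R =
  3 * (expR (step_const * D + 60 * delta * i.+1%:R) * (3 * dirac_a U m0.+1%:R)) by ring.
rewrite ler_pM2l//; apply: le_trans h3 _.
apply: le_trans (ler_wpM2l (expR_ge0 _) h4) _.
rewrite [leLHS]mulrA -expRD.
apply: (@le_trans _ _ (expR (step_const * D + 60 * delta * i.+1%:R) * G m0 m0.+1%:R)); last first.
  by rewrite ler_wpM2l ?expR_ge0.
rewrite ler_wpM2r//.
  have [h _] := dirac_lyap_bounds U (riccati_small m0.+1%:R (leqnn m0)).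
  by have := dirac_a_ge0 U m0.+1%:R; lra.
rewrite ler_expR -[i.+1%:R]natr1.
have sumd : \sum_(j < i) d (m0 + j) + d (m0 + i) <= D.
  apply: le_trans (dD (m0 + i).+1).
  by rewrite big_ord_recr /= lerD2r big_split_ord /= lerDr sumr_ge0.
have : step_const * (\sum_(j < i) d (m0 + j) + d (m0 + i)) <= step_const * D.
  by rewrite ler_wpM2l.
have : 30 * X1 * d (m0 + i) <= step_const * d (m0 + i).
  by rewrite ler_wpM2r// /step_const /X1 lerDl mulr_ge0.
nra.
Qed.

End Growth.

(** * Uniform constants, behaviour near zero, and truncation of the potential *)

Section Limits.
Variable R : realType.

Lemma bounded_series_tail (u : nat -> R) (K delta : R) : (forall i, 0 <= u i) ->
    (forall M, \sum_(i < M) u i <= K) -> 0 < delta ->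
  exists N, forall M, (N <= M)%N -> \sum_(i < M) u i - \sum_(i < N) u i <= delta.
Proof.
move=> u0 uK delta0; pose A := [set s : R | exists M, s = \sum_(i < M) u i].
have supA : has_sup A.
  split; first by exists 0, 0%N; rewrite big_ord0.
  by exists K => _ [M ->].
have [_ [N ->] hN] := sup_adherent delta0 supA.
exists N => M _; have : \sum_(i < M) u i <= sup A by apply: sup_upper_bound => //; exists M.
by move: hN; lra.
Qed.

Lemma normc_lim_le (f : nat -> R[i]) (l z : R[i]) (K : R) (N : nat) :
    (f : nat -> R[i]^o) @ \oo --> (l : R[i]^o) ->
    (forall M, (N <= M)%N -> normc (z - f M) <= K) ->
  normc (z - l) <= K.
Proof.
move=> fl fK; apply/ler_addgt0Pr => e e0.
have eC : 0 < e%:C :> R[i] by rewrite ltcR.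
have /cvgrPdist_lt /(_ _ eC) [M _ HM] := fl.
have := HM (maxn M N) (leq_maxl _ _); rewrite /= => h.
have {}h : normc (l - f (maxn M N)) < e by rewrite -ltcR; exact: h.
have -> : z - l = (z - f (maxn M N)) - (l - f (maxn M N)) by rewrite opprB addrA subrK.
apply: le_trans (le_normcD _ _) _; rewrite normcN lerD ?(ltW h)//.
by apply: fK; exact: leq_maxr.
Qed.

Lemma ereal_sup_bound (I : Type) (f : I -> \bar R) :
  (ereal_sup [set f j | j in [set: I]] < +oo)%E ->
  exists2 t : R, 0 <= t & forall j, (f j <= t%:E)%E.
Proof.
move=> H; set s := ereal_sup _ in H.
have fs j : (f j <= s)%E by apply: ereal_sup_ubound; exists j.
exists (Num.max 0 (fine s)); first by rewrite le_max lexx.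
move=> j; apply: le_trans (fs j) _; move: H; case: s {fs} => //= [x|] _.
  by rewrite lee_fin le_max lexx orbT.
exact: leNye.
Qed.

End Limits.

Section Constants.
Variables (R : realType) (c : nat -> R[i]) (phi : nat -> R) (eta : R).
Variables (T L : R) (y : nat -> nat -> R).
Hypothesis T0 : 0 <= T.
Hypothesis L0 : 0 <= L.
Hypothesis y0 : forall k m, 0 <= y k m.
Hypothesis yL : forall k M, \sum_(m < M) y k m <= L.
Local Notation C := (fun k => T * normc (c k)).

Lemma all_word_pairs_weights n :
    (forall a, (a < n)%N -> (\esum_(kl in [set: a.+1.-tuple nat * a.-tuple nat])
       hterm c phi eta a.*2.+1 kl.1 kl.2 < +oo)%E) ->
  exists S : R, exists d : nat -> R, exists D : R,
    [/\ 0 <= S, forall m, 0 <= d m, forall M, \sum_(m < M) d m <= D &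
    forall (J : seq nat) a, uniq J -> {in J, forall k, c k != 0} -> (a < n)%N ->
    [/\ forall ks ls, ks \in words J a.+1 -> ls \in words J a ->
          ~~ is_pole (hfun a.*2.+1 (map phi ks) (map phi ls)) eta,
        \sum_(q <- word_pairs J a) pair_weight phi eta C a q <= S &
        forall m, \sum_(q <- word_pairs J a) pair_weight phi eta C a q *
          \sum_(k <- q.1 ++ q.2) y k m <= d m]].
Proof.
elim: n => [|n IH] H.
  by exists 0, (fun=> 0), 0; split=> // M; rewrite big1.
have [|S [d [D [S0 d0 dD HJ]]]] := IH; first by move=> a an; apply: H; exact: ltnW.
have [S' [d' [D' [S'0 d'0 dD' HJ']]]] := word_pairs_weights T0 L0 y0 yL (H n (ltnSn n)).
exists (S + S'), (fun m => d m + d' m), (D + D'); split.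
- exact: addr_ge0.
- by move=> m; exact: addr_ge0.
- by move=> M; rewrite big_split lerD.
move=> J a uJ Jc; rewrite ltnS leq_eqVlt => /predU1P[->|an].
  have [h1 h2 h3] := HJ' J uJ Jc; split=> //; first by rewrite (le_trans h2)// lerDr.
  by move=> m; rewrite (le_trans (h3 m))// lerDr.
have [h1 h2 h3] := HJ J a uJ Jc an; split=> //; first by rewrite (le_trans h2)// lerDl.
by move=> m; rewrite (le_trans (h3 m))// lerDl.
Qed.

Lemma coef_weights (Sc : R) : (forall s, uniq s -> \sum_(k <- s) normc (c k) <= Sc) ->
  exists d : nat -> R, [/\ forall m, 0 <= d m, forall M, \sum_(m < M) d m <= T * Sc * L &
    forall m s, uniq s -> \sum_(k <- s) C k * y k m <= d m].
Proof.
move=> cS; apply: esum_weighted => //.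
  by move=> k; rewrite mulr_ge0// normc_ge0.
by move=> s us; rewrite -mulr_sumr ler_wpM2l// cS.
Qed.

End Constants.

Section NearZero.
Variables (R : realType) (varphi : R -> R[i]) (eta : R) (U : R -> 'cV[R[i]]_2).
Hypothesis Usol : Dirac_solution varphi (eta / 2) U.

(** By Cauchy-Schwarz and 2 |b| <= a one has |a'| <= 2 K a. The exponent is independent of [x], so
    the bound persists as [x] tends to 0. *)
Lemma dirac_a_backward (K x b : R) : (forall t, 0 < t -> normc (varphi t) <= K) ->
  0 < x -> x <= b -> dirac_a U x <= expR (2 * K * b) * dirac_a U b.
Proof.
move=> phiK x0 xb; have [N N0 ode] := dirac_ode_ae Usol.
have K0 : 0 <= K by apply: le_trans (phiK x x0); exact: normc_ge0.
have dac := acontN (acont_dirac_a Usol x0 xb).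
have : - dirac_a U b <= expR (- (2 * K) * (b - x)) * (- dirac_a U x).
  apply: (acont_gronwall xb dac N0) => t /andP[xt tb] Nt.
  have t0 : 0 < t by exact: lt_le_trans xt.
  have [da _ _] := dirac_quadratic_derive (ode t t0 Nt).
  eexists; first exact: is_derive_oppf da.
  have a2 : 0 <= dirac_a U t / 2 by have := dirac_a_ge0 U t; lra.
  have hphi : complex.Re (varphi t) ^+ 2 + complex.Im (varphi t) ^+ 2 <= K ^+ 2.
    by rewrite -normc_sqr lerXn2r ?nnegrE ?normc_ge0 ?phiK.
  have hb : complex.Im (dirac_b U t) ^+ 2 + complex.Re (dirac_b U t) ^+ 2 <=
      (dirac_a U t / 2) ^+ 2.
    by have := dirac_b_le U t; rewrite expr_div_n; lra.
  have := cauchy_schwarz2 K0 a2 hphi hb; rewrite ler_norml => /andP[h1 h2].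
  have := mulr_ge0 K0 (dirac_a_ge0 U t); nra.
rewrite mulrN lerN2 => h.
have e0 : 0 < expR (2 * K * (b - x)) by exact: expR_gt0.
have : dirac_a U x <= expR (2 * K * (b - x)) * dirac_a U b.
  have := ler_wpM2l (ltW e0) h.
  by rewrite mulrA -expRD mulNr addrN expR0 mul1r.
move/le_trans; apply; rewrite ler_wpM2r ?dirac_a_ge0// ler_expR ler_wpM2l ?mulr_ge0//.
lra.
Qed.

End NearZero.

Section Potential.
Variables (R : realType) (c : nat -> R[i]) (phi : nat -> R) (gamma : nat -> R -> R[i]).
Variables (varphi : R -> R[i]) (T Sc : R).
Hypothesis hvarphi : forall x : R, 0 < x ->
  (fun N : nat => \sum_(0 <= j < N) c j * expi (- phi j * x) * gamma j x
     : R[i]^o) @ \oo --> (varphi x : R[i]^o).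
Hypothesis T0 : 0 < T.
Hypothesis gammaT : forall j x, 0 < x -> normc (gamma j x) <= T.
Hypothesis cS : forall s, uniq s -> \sum_(k <- s) normc (c k) <= Sc.

Let sum_terms_le (x : R) (s : seq nat) : 0 < x ->
  normc (\sum_(j <- s) c j * expi (- phi j * x) * gamma j x) <=
  T * \sum_(j <- s) normc (c j).
Proof.
move=> x0; apply: le_trans (normc_sum _ _ _) _; rewrite mulr_sumr.
apply: ler_sum => j _; rewrite !normcM normc_expi mulr1 mulrC.
by rewrite ler_wpM2r ?normc_ge0 ?gammaT.
Qed.

Lemma potential_bounded (x : R) : 0 < x -> normc (varphi x) <= T * Sc.
Proof.
move=> x0; rewrite -normcN -sub0r.
apply: (normc_lim_le (N := 0%N) (hvarphi x0)) => M _.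
rewrite sub0r normcN; apply: le_trans (sum_terms_le _ x0) _.
by rewrite ler_wpM2l ?(ltW T0)// cS// iota_uniq.
Qed.

(** Freezing the first [N] functions at [s] costs [d]; cutting the series at [N] costs [T] times the
    tail of the coefficients. Discarding the indices with zero coefficient changes nothing. *)
Lemma truncated_potential_close (N : nat) (s x delta d : R) (y : nat -> R) :
    0 < s -> 0 < x ->
    (forall M, (N <= M)%N ->
      \sum_(i < M) normc (c i) - \sum_(i < N) normc (c i) <= delta / T) ->
    (forall j, normc (gamma j x - gamma j s) <= y j) ->
    \sum_(0 <= j < N) normc (c j) * y j <= d ->
  normc (\sum_(j <- [seq j <- index_iota 0 N | c j != 0])
           wave phi (fun k => c k * gamma k s) j x - varphi x) <= d + delta.
Proof.
move=> s0 x0 tail gy yd; rewrite big_filter.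
have -> : \sum_(j <- index_iota 0 N | c j != 0) wave phi (fun k => c k * gamma k s) j x =
    \sum_(0 <= j < N) c j * expi (- phi j * x) * gamma j s.
  rewrite big_mkcond; apply: eq_bigr => j _; rewrite /wave; case: eqP => [->|_] /=.
    by rewrite !mul0r.
  by ring.
apply: (normc_lim_le (N := N) (hvarphi x0)) => M NM.
rewrite (big_cat_nat (leq0n N) NM)//= opprD addrA -sumrB.
apply: le_trans (le_normcD _ _) _; rewrite normcN lerD//.
  apply: le_trans (normc_sum _ _ _) _; apply: le_trans yd; apply: ler_sum => j _.
  rewrite -mulrBr !normcM normc_expi mulr1 ler_wpM2l ?normc_ge0//.
  by rewrite -normcN opprB.
apply: le_trans (sum_terms_le _ x0) _.
rewrite mulrC -ler_pdivlMr//; apply: le_trans (tail M NM).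
have E k : \sum_(i < k) normc (c i) = \sum_(0 <= i < k) normc (c i) by rewrite big_mkord.
by rewrite !E (big_cat_nat (leq0n N) NM)//= addrAC subrr add0r.
Qed.

End Potential.

Lemma sum_ord_mono (R : realType) (u : nat -> R) (N M : nat) : (forall i, 0 <= u i) ->
  (N <= M)%N -> \sum_(i < N) u i <= \sum_(i < M) u i.
Proof.
by move=> u0 NM; rewrite -(subnKC NM) big_split_ord /= lerDl sumr_ge0.
Qed.

Lemma dirac_bounded (R : realType) (U : R -> 'cV[R[i]]_2) (M : R) :
  (forall x, 0 < x -> dirac_a U x <= M) -> bounded_on_pos U.
Proof.
move=> aM; exists (1 + M) => x x0 r; apply: le_trans (lerD (lexx 1) (aM x x0)).
rewrite dirac_aE.
have sq (z : R) : z <= 1 + z ^+ 2.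
  rewrite -subr_ge0 (_ : _ - _ = (z - 1 / 2) ^+ 2 + 3 / 4); last by field.
  by rewrite addr_ge0 ?sqr_ge0 ?divr_ge0.
have : r = 0 \/ r = 1.
  by case: r => -[|[|//]] i; [left|right]; apply: val_inj.
case=> ->; apply: le_trans (sq _) _; rewrite lerD2l.
  by rewrite lerDl sqr_ge0.
by rewrite lerDr sqr_ge0.
Qed.

Theorem lemma1p4 (R : realType) (c : nat -> R[i]) (phi : nat -> R)
    (gamma : nat -> R -> R[i]) (varphi : R -> R[i]) (eta : R) (n p : nat)
    (hvarphi : forall x : R, 0 < x ->
      (fun N : nat => \sum_(0 <= j < N) c j * expi (- phi j * x) * gamma j x
         : R[i]^o) @ \oo --> (varphi x : R[i]^o))
    (hVar : (ereal_sup [set Var (gamma j) | j in [set: nat]] < +oo)%E)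
    (hn : (1 <= n)%N) (hp : p = (2 * n + 1)%N)
    (hLp : (ereal_sup [set (\int[@lebesgue_measure R]_(t in `]0%R, +oo[)
               (normc (gamma j t) ^+ p)%:E) | j in [set: nat]] < +oo)%E)
    (hc : (\sum_(0 <= j <oo) (normc (c j))%:E < +oo)%E)
    (hh : forall I : nat, odd I -> (1 <= I <= p - 2)%N ->
      let P := (I.+1)./2 in
      (\esum_(kl in [set: P.-tuple nat * P.-1.-tuple nat])
         hterm c phi eta I kl.1 kl.2 < +oo)%E) :
  forall U : R -> 'cV[R[i]]_2,
    Dirac_solution varphi (eta / 2) U -> bounded_on_pos U.
Proof.
move=> U Usol.
have [tau tau0 gV] := ereal_sup_bound hVar.
have [sigma sigma0 gL] := ereal_sup_bound hLp.
have pn : p = n.*2.+1 by rewrite hp; lia.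
have p0 : (0 < p)%N by rewrite pn.
have [y hy] := choice (fun j => gamma_steps p0 tau0 (gV j) (gL j)).
have y0 j m : 0 <= y j m by have [] := hy j.
have yL j M : \sum_(m < M) y j m <= sigma + tau by have [] := hy j.
have yg j m t : m.+1%:R <= t <= m.+2%:R -> normc (gamma j t - gamma j m.+1%:R) <= y j m.
  by have [_ _ + _ _] := hy j; apply.
pose T := tau + 1; have T1 : 1 <= T by rewrite /T lerDr.
have T0 : 0 < T by exact: lt_le_trans T1.
have yp j m : normc (gamma j m.+1%:R) ^+ p <= (2 * T) ^+ p * y j m by have [] := hy j.
have gT j x : 0 < x -> normc (gamma j x) <= T by have [_ _ _ _ +] := hy j; apply.
have L0 : 0 <= sigma + tau by exact: addr_ge0.
have c0 j : 0 <= normc (c j) by exact: normc_ge0.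
have [Sc cS] : exists Sc, forall s : seq nat, uniq s -> \sum_(k <- s) normc (c k) <= Sc.
  exists (fine (\sum_(0 <= j <oo) (normc (c j))%:E)%E) => s us.
  rewrite -lee_fin fineK; last first.
    by rewrite ge0_fin_numE//; apply: nneseries_ge0 => j _ _; rewrite lee_fin.
  by rewrite nneseries_esumT//; exact: esum_ge_finite.
have Sc0 : 0 <= Sc by have := cS [::] isT; rewrite big_nil.
have [a an|S1 [d1 [D1 [S10 d10 dD1 HJ]]]] :=
    @all_word_pairs_weights R c phi eta T _ y (ltW T0) L0 y0 yL n.
  have oa : odd a.*2.+1 by rewrite /= odd_double.
  have ap : (1 <= a.*2.+1 <= p - 2)%N by rewrite pn; lia.
  have := hh _ oa ap; have -> // : ((a.*2.+1).+1./2 = a.+1)%N.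
  by rewrite -doubleS doubleK.
have [d2 [d20 dD2 HC]] := coef_weights (ltW T0) L0 y0 yL cS.
pose S := S1 + T * Sc; pose d m := d1 m + d2 m; pose D := D1 + T * Sc * (sigma + tau).
have S0 : 0 <= S by rewrite addr_ge0 ?mulr_ge0// ltW.
have d0 m : 0 <= d m by exact: addr_ge0.
have dD M : \sum_(m < M) d m <= D by rewrite big_split lerD.
(* Normalization: the sampled values get modulus at most 1, as the product inequalities require, and
   the factor [T] moves into the coefficients. *)
pose b k := T%:C * c k; pose u m k := (T^-1)%:C * gamma k m.+1%:R.
have bC k : normc (b k) = T * normc (c k) by rewrite normcM normc_real gtr0_norm.
have bCf : (fun k => normc (b k)) = (fun k => T * normc (c k)) by exact/funext.
have bu m k : b k * u m k = c k * gamma k m.+1%:R.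
  by rewrite /b /u mulrACA -rmorphM divff ?gt_eqF// mul1r.
have nT (z : R[i]) : normc ((T^-1)%:C * z) = normc z / T.
  by rewrite normcM normc_real gtr0_norm ?invr_gt0// mulrC.
have u1 m k : normc (u m k) <= 1 by rewrite nT ler_pdivrMr// mul1r gT.
have uy m k : normc (u m.+1 k - u m k) <= y k m.
  rewrite -mulrBr nT ler_pdivrMr//; apply: le_trans (yg k m m.+2%:R _) _.
    by rewrite lexx ler_nat leqnSn.
  by rewrite ler_peMr.
have up m k : normc (u m k) ^+ p <= 2 ^+ p * y k m.
  rewrite nT expr_div_n ler_pdivrMr ?exprn_gt0//; apply: le_trans (yp k m) _.
  by rewrite exprMn mulrAC.
have n0 : 0 < n%:R :> R by rewrite ltr0n.
(* Chosen so that [n * (e * S) <= 1/4], with [S + 1] since [S] may be 0. The other quarter of the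
   bound 1/2 comes from [d m <= (4 * n * Q)^-1] for [m >= m0]. *)
pose e := (4 * n%:R * (S + 1))^-1 : R.
have Sp : 0 < S + 1 by exact: ltr_wpDl.
have e0 : 0 < e by rewrite invr_gt0; apply: mulr_gt0 => //; exact: mulr_gt0.
pose Q := (e ^+ p)^-1 * 2 ^+ p; have Q0 : 0 < Q.
  by rewrite mulr_gt0 ?invr_gt0 ?exprn_gt0.
have q0 : 0 < (4 * n%:R * Q)^-1 by rewrite invr_gt0; apply: mulr_gt0 => //; exact: mulr_gt0.
have [m0 tail0] := bounded_series_tail d0 dD q0.
have small m : (m0 <= m)%N -> n%:R * (e * S + (e ^+ p)^-1 * 2 ^+ p * d m) <= 1 / 2.
  move=> mm; have dm : d m <= (4 * n%:R * Q)^-1.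
    apply: le_trans (tail0 m.+1 (leqW mm)); rewrite big_ord_recr /= addrAC lerDr subr_ge0.
    exact: sum_ord_mono.
  have : n%:R * (Q * d m) <= 1 / 4.
    apply: (@le_trans _ _ (n%:R * (Q * (4 * n%:R * Q)^-1))).
      by rewrite ler_wpM2l ?(ltW n0)// ler_wpM2l ?(ltW Q0).
    by rewrite le_eqVlt; apply/predU1P; left; field; rewrite !gt_eqF.
  have : n%:R * (e * S) <= 1 / 4.
    apply: (@le_trans _ _ (n%:R * (e * (S + 1)))).
      by rewrite ler_wpM2l ?(ltW n0)// ler_wpM2l ?(ltW e0)// lerDl.
    by rewrite le_eqVlt; apply/predU1P; left; rewrite /e; field;
      rewrite !gt_eqF.
  rewrite -/Q mulrDr; lra.
have far t : m0.+1%:R <= t ->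
    dirac_a U t <= 9 * expR (step_const n S (2 ^+ p) * D + 60) * dirac_a U m0.+1%:R.
  move=> mt; have t0 : 0 <= t by exact: le_trans mt.
  have /andP[k1 k2] := truncn_itv t0; set k := Num.truncn t in k1 k2.
  have mk : (m0.+1 <= k)%N.
    by rewrite -ltnS -(ltr_nat R); exact: le_lt_trans mt k2.
  pose i := (k - m0.+1)%N; have ki : (m0 + i).+1 = k by rewrite -addSn subnKC.
  (* The truncation is adapted to [t]: an error [delta] on each of the i + 1 intervals accumulates
     to [60 * delta * (i + 1) = 60], whatever [t]. *)
  pose delta : R := i.+1%:R^-1; have delta0 : 0 < delta by rewrite invr_gt0.
  have cM M : \sum_(j < M) normc (c j) <= Sc.
    have -> : \sum_(j < M) normc (c j) = \sum_(0 <= j < M) normc (c j) by rewrite big_mkord.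
    by rewrite cS// iota_uniq.
  have [N tailN] := bounded_series_tail c0 cM (divr_gt0 delta0 T0).
  (* Condition 4 allows h_I to have a pole at words containing an index with zero coefficient; such
     indices must not enter [r]. *)
  pose J := [seq j <- index_iota 0 N | c j != 0].
  have uJ : uniq J by rewrite filter_uniq// iota_uniq.
  have Jc : {in J, forall k, c k != 0} by move=> j; rewrite mem_filter => /andP[].
  have -> : 60 = 60 * delta * i.+1%:R by rewrite /delta -mulrA mulVf ?mulr1.
  apply: (@dirac_a_growth R varphi eta U Usol phi n p J b u y S (2 ^+ p) D e delta d m0) => //.
  - by move=> a ks ls an; have [+ _ _] := HJ J a uJ Jc an; apply.
  - under eq_bigr do rewrite bC.
    by rewrite -mulr_sumr (@le_trans _ _ (T * Sc))// ?lerDr// ler_wpM2l ?cS// ltW.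
  - move=> m; under eq_bigr do rewrite bC.
    by rewrite (le_trans (HC m J uJ))// lerDr.
  - move=> a an; rewrite bCf; have [_ h _] := HJ J a uJ Jc an.
    by rewrite (le_trans h)// lerDl mulr_ge0// ltW.
  - move=> a m an; rewrite bCf; have [_ _ h] := HJ J a uJ Jc an.
    by rewrite (le_trans (h m))// lerDl.
  - exact: ltW.
  - move=> m s /andP[ms sm].
    have s0 : 0 < s by exact: lt_le_trans ms.
    rewrite (_ : (fun k => b k * u m k) = (fun k => c k * gamma k m.+1%:R)); last first.
      by apply/funext => j; exact: bu.
    have m1 : 0 < m.+1%:R :> R by [].
    apply: (truncated_potential_close hvarphi T0 gT m1 s0 tailN) => //.
      by move=> j; apply: yg; rewrite ms.
    apply: (@le_trans _ _ (\sum_(0 <= j < N) T * normc (c j) * y j m)).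
      by apply: ler_sum => j _; rewrite ler_wpM2r// ler_peMl.
    by rewrite (le_trans (HC m _ (iota_uniq _ _)))// lerDr.
  - by rewrite ki k1 ltW.
have near0 x : 0 < x -> x <= m0.+1%:R ->
    dirac_a U x <= expR (2 * (T * Sc) * m0.+1%:R) * dirac_a U m0.+1%:R.
  exact: (dirac_a_backward Usol (fun t => potential_bounded hvarphi T0 gT cS (x := t))).
have [M MP] : exists M, M = Num.max (expR (2 * (T * Sc) * m0.+1%:R) * dirac_a U m0.+1%:R)
  (9 * expR (step_const n S (2 ^+ p) * D + 60) * dirac_a U m0.+1%:R) by eexists.
apply: (@dirac_bounded R U M) => x x0; rewrite MP le_max.
have [xm|mx] := leP x m0.+1%:R; first by rewrite near0.
by rewrite far ?orbT// ltW.
Qed.
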